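(* Let $(\Omega,\mathcal F)$ be a standard measurable space, $\tau:\Omega\to\Omega$ an $\mathcal F/\mathcal F$-measurable transformation, and $\nu:\mathcal F\to[0,1]$ a lower probability. Let $\{S_n\}_{n\in\mathbb N}$ be either a superadditive or a subadditive sequence of $\mathcal F$-measurable real-valued functions such that, for some $\lambda\in\mathbb R$, $-\lambda n\le S_n(\omega)\le\lambda n$ for all $\omega\in\Omega$ and all $n\in\mathbb N$. If $\nu$ is functionally invariant, then there exists $f^\star\in B(\Omega,\mathcal G)$ such that $$\lim_n\frac{S_n}{n}=f^\star\qquad\nu\text{-a.s.}$$ Moreover: 1. If $\nu$ is convex and strongly invariant and $\{S_n\}_{n\in\mathbb N}$ is superadditive, then $\int_\Omega f^\star\,d\nu=\sup_{n\in\mathbb N}\int_\Omega\frac{S_n}{n}\,d\nu$. 2. If $\nu$ is convex and strongly invariant and $\{S_n\}_{n\in\mathbb N}$ is subadditive, then $\int_\Omega f^\star\,d\bar\nu=\inf_{n\in\mathbb N}\int_\Omega\frac{S_n}{n}\,d\bar\nu$. 3. If $\nu$ is ergodic and $\{S_n\}_{n\in\mathbb N}$ is either subadditive or superadditive, then $$\nu\left(\left\{\omega\in\Omega:\int_\Omega f^\star\,d\nu\le\lim_n\frac{S_n(\omega)}{n}\le\int_\Omega f^\star\,d\bar\nu\right\}\right)=1 .$$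
   Context: $\mathbb N=\{1,2,\dots\}$. A probability measure means a countably additive probability; $\Delta^\sigma(\Omega,\mathcal F)$ is the set of all probability measures on $\mathcal F$, with the topology of setwise convergence of nets ($P_\alpha\to P$ iff $P_\alpha(A)\to P(A)$ for all $A\in\mathcal F$). A set function $\nu:\mathcal F\to[0,1]$ is a lower probability if there is a compact set $\mathcal M\subseteq\Delta^\sigma(\Omega,\mathcal F)$ with $\nu(A)=\min_{P\in\mathcal M}P(A)$ for all $A\in\mathcal F$. Its conjugate is $\bar\nu(A)=1-\nu(A^c)$. $\nu$ is convex if $\nu(A\cup B)+\nu(A\cap B)\ge\nu(A)+\nu(B)$ for all $A,B\in\mathcal F$. $\mathcal I$ is the set of probability measures $P$ on $\mathcal F$ with $P(A)=P(\tau^{-1}(A))$ for all $A\in\mathcal F$. $\nu$ is functionally invariant if there is a compact set $\mathcal M\subseteq\Delta^\sigma(\Omega,\mathcal F)$ with $\nu(A)=\min_{P\in\mathcal M}P(A)$ for all $A\in\mathcal F$ and $\mathcal M\subseteq\mathcal I$. $\nu$ is strongly invariant if for each $A\in\mathcal F$, $\nu(A\setminus\tau^{-1}(A))=\bar\nu(\tau^{-1}(A)\setminus A)$ and $\nu(\tau^{-1}(A)\setminus A)=\bar\nu(A\setminus\tau^{-1}(A))$. $\mathcal G=\{A\in\mathcal F:\tau^{-1}(A)=A\}$; $\nu$ is ergodic if $\nu(\mathcal G)=\{\nu(A):A\in\mathcal G\}=\{0,1\}$. The sequence $\{S_n\}$ is superadditive (resp. subadditive) if $S_{n+k}\ge S_n+S_k\circ\tau^n$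 (resp. $\le$) for all $n,k\in\mathbb N$. For a $\sigma$-algebra $\mathcal H$, $B(\Omega,\mathcal H)$ is the set of bounded $\mathcal H$-measurable functions $\Omega\to\mathbb R$. For a monotone set function $\nu$ with $\nu(\emptyset)=0$, $\nu(\Omega)=1$, and $f\in B(\Omega,\mathcal F)$, the Choquet integral is $\int_\Omega f\,d\nu=\int_0^\infty\nu(\{f\ge t\})\,dt+\int_{-\infty}^0[\nu(\{f\ge t\})-\nu(\Omega)]\,dt$. A statement holds $\nu$-a.s. if there is $A\in\mathcal F$ with $\nu(A)=1$ such that it holds for all $\omega\in A$. In sets whose description involves a limit, membership of $\omega$ includes existence of the limit at $\omega$. A standard measurable space is a standard Borel space. *)

(* Defs.v *)
From HB Require Import structures.
From mathcomp Require Import all_boot all_order all_algebra.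
From mathcomp Require Import all_classical all_reals all_analysis.

Set Implicit Arguments.
Unset Strict Implicit.
Unset Printing Implicit Defensive.

Import Order.TTheory GRing.Theory Num.Theory.
Import numFieldNormedType.Exports.

Local Open Scope classical_set_scope.
Local Open Scope ring_scope.

Definition polish (R : realType) (X : metricType R) : Prop :=
  (exists2 D : set X, countable D & dense D) /\
  (forall F : set_system X, ProperFilter F -> cauchy F -> exists x : X, F --> x).

(* The Polish topology on T is carried over from X along the bijection f. *)
Definition standard_borel (R : realType) (d : measure_display)
    (T : measurableType d) : Prop :=
  exists (X : metricType R) (f : T -> X),
    [/\ polish X, bijective f &
        @measurable d T = [set f @^-1` B | B in <<s @open X >>] ].

Section SetwiseTopology.
Context (R : realType) (d : measure_display) (T : measurableType d).

Definition evaluations (P : probability T R) :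
    {ptws {A : set T | measurable A} -> R} :=
  fun A => fine (P (sval A)).

(* The set of all probability measures with the topology of setwise
   convergence; see [cvg_setwise]. *)
Definition setwise_probability : Type := initial_topology evaluations.
HB.instance Definition _ :=
  Topological.copy setwise_probability (initial_topology evaluations).

Lemma cvg_setwise (F : set_system setwise_probability)
    (P : setwise_probability) : Filter F ->
  F --> P <-> forall A : set T, measurable A ->
    fine ((Q : probability T R) A) @[Q --> F] -->
      fine ((P : probability T R) A).
Proof.
move=> FF; split=> [FP A mA|FP].
  have FE : {ptws, evaluations Q @[Q --> F] --> evaluations P}.
    apply: (@cvg_comp _ _ _ id evaluations F (nbhs P)) => //.
    exact: (@initial_continuous _ _ evaluations P).
  pose i : {A : set T | measurable A} := exist _ A mA.
  have /cvg_sup/(_ i) FEi := FE.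
  apply: (@cvg_comp _ _ _ evaluations (fun g => g i) F _ _ FEi).
  exact: (@initial_continuous _ _
    (fun g : {ptws {A : set T | measurable A} -> R} => g i) (evaluations P)).
have FE : {ptws, evaluations Q @[Q --> F] --> evaluations P}.
  apply/cvg_sup => -[A mA] U.
  rewrite nbhsE => -[V [[W oW <-] WP] VU].
  rewrite nbhs_filterE; apply: filterS VU _.
  by apply: (FP A mA); exact: open_nbhs_nbhs.
move=> U; rewrite nbhsE => -[V [[W oW <-] WP] VU].
rewrite nbhs_filterE; apply: filterS VU _.
by apply: FE; apply: open_nbhs_nbhs.
Qed.

End SetwiseTopology.

Section LowerProbabilities.
Context (R : realType) (d : measure_display) (T : measurableType d).

(* A set function on the sigma-algebra is encoded as a function on all sets;
   only its values at measurable sets are ever constrained or used. *)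
Implicit Types (nu : set T -> R) (M : set (probability T R)) (tau : T -> T).

Definition is_lower_envelope M nu : Prop :=
  forall A, measurable A ->
    (exists2 P, M P & P A = (nu A)%:E) /\
    (forall P, M P -> ((nu A)%:E <= P A)%E).

Definition lower_probability nu : Prop :=
  (forall A, measurable A -> 0 <= nu A <= 1) /\
  exists M : set (probability T R),
    compact (M : set (setwise_probability R T)) /\ is_lower_envelope M nu.

Definition conjugate nu : set T -> R := fun A => 1 - nu (~` A).

Definition convex_set_function nu : Prop :=
  forall A B, measurable A -> measurable B ->
    nu A + nu B <= nu (A `|` B) + nu (A `&` B).

Definition invariant_probabilities tau : set (probability T R) :=
  [set P | forall A, measurable A -> P A = P (tau @^-1` A)].

Definition functionally_invariant tau nu : Prop :=
  exists M : set (probability T R),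
    [/\ compact (M : set (setwise_probability R T)),
        is_lower_envelope M nu &
        M `<=` invariant_probabilities tau].

Definition strongly_invariant tau nu : Prop :=
  forall A, measurable A ->
    nu (A `\` tau @^-1` A) = conjugate nu (tau @^-1` A `\` A) /\
    nu (tau @^-1` A `\` A) = conjugate nu (A `\` tau @^-1` A).

Definition invariant_sets tau : set (set T) :=
  [set A | measurable A /\ tau @^-1` A = A].

Lemma sigma_algebra_invariant_sets tau :
  sigma_algebra [set: T] (invariant_sets tau).
Proof.
split.
- by split; [exact: measurable0|rewrite preimage_set0].
- move=> A [mA iA]; rewrite setTD; split; first exact: measurableC.
  by rewrite -preimage_setC iA.
- move=> A iA; split; first by apply: bigcup_measurable => i _; case: (iA i).
  by rewrite preimage_bigcup; apply: eq_bigcupr => i _; case: (iA i).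
Qed.

Definition ergodic tau nu : Prop := nu @` invariant_sets tau = [set 0; 1].

(* For a sigma-algebra H, such as [invariant_sets tau], the sigma-algebra of
   [g_sigma_algebraType H] is H itself. *)
Definition bounded_measurable (H : set (set T)) (f : T -> R) : Prop :=
  measurable_fun [set: g_sigma_algebraType H] f /\
  exists K : R, forall w, `|f w| <= K.

Definition choquet nu (f : T -> R) : R :=
  \int[lebesgue_measure]_(t in `[0, +oo[) nu [set w | t <= f w] +
  \int[lebesgue_measure]_(t in `]-oo, 0])
    (nu [set w | t <= f w] - nu [set: T]).

(* Sequences are indexed by the positive integers; S 0 is a dummy value. *)
Definition superadditive_process tau (S : nat -> T -> R) : Prop :=
  forall n k, (0 < n)%N -> (0 < k)%N ->
    forall w, S n w + S k (iter n tau w) <= S (n + k)%N w.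

Definition subadditive_process tau (S : nat -> T -> R) : Prop :=
  forall n k, (0 < n)%N -> (0 < k)%N ->
    forall w, S (n + k)%N w <= S n w + S k (iter n tau w).

Definition almost_surely nu (Q : T -> Prop) : Prop :=
  exists A, [/\ measurable A, nu A = 1 & forall w, A w -> Q w].

End LowerProbabilities.

(* Main.v *)
(* A lower probability with an invariant compact envelope M assigns 1 to a set iff
   every P in M does, so a.s. convergence reduces to Kingman's theorem for each
   invariant P; the limit is chosen strictly invariant and independently of P by
   replacing f = liminf S_n / n, which satisfies f <= f o tau, by the increasing
   limit of f o tau^k.

   Kingman's theorem is proved by the Katznelson-Weiss covering argument. Let g be
   the invariant limit and B the set of points with S_n > n (g + e) for all n <= N.
   Cutting orbits greedily gives
     S_m <= m (g + e) + 2 lam sum_(k < m) 1_B o tau^k + 2 lam N.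
   For additive S, integration yields E a <= E (liminf of the averages of a);
   applied to a = - 1_B this bounds E (limsup S_m / m) by E g + e + 2 lam P(B).

   When nu is convex the Choquet integral is superadditive, and it is invariant
   because nu is; so superadditive S give choquet (S_n / n) <= choquet (S_mn / (m n)).
   Compactness of M makes nu continuous along sets increasing to a set of
   nu-measure 1, so by Egorov's argument choquet (S_n / n) tends to the integral of
   the limit, which is therefore the supremum. The subadditive case follows from
   choquet (conjugate nu) f = - choquet nu (- f).

   When nu is ergodic, t |-> nu {f >= t} only takes the values 0 and 1, and it is 1
   up to t = choquet nu f. *)
Require Import Defs.
From HB Require Import structures.
From mathcomp Require Import all_boot all_order all_algebra.
From mathcomp Require Import all_classical all_reals all_analysis.
From mathcomp Require Import measurable_realfun ring lra.
Import Order.TTheory GRing.Theory Num.Theory.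
Import numFieldNormedType.Exports.
Local Open Scope classical_set_scope.
Local Open Scope ring_scope.

Set Implicit Arguments.
Unset Strict Implicit.
Unset Printing Implicit Defensive.

(** * Limits inferior and means of bounded functions *)

Section LimInf.
Context {R : realType}.
Implicit Types (u : nat -> R) (c K : R).

Lemma normr_le_bounded_fun u K : (forall n, `|u n| <= K) -> bounded_fun u.
Proof.
move=> uK; exists K; split; first exact: num_real.
by move=> M KM n _; apply: le_trans (uK n) _; exact: ltW.
Qed.

Lemma lt_limn_inf u K c : (forall n, `|u n| <= K) -> c < limn_inf u ->
  exists N, forall n, (N <= n)%N -> c < u n.
Proof.
move=> uK; have bu := normr_le_bounded_fun uK.
rewrite limn_infE// => /sup_gt[|_ [N _ <-] cN]; first by exists (infs u 0), 0.
exists N => n Nn; apply: (lt_le_trans cN); apply: ge_inf; last by exists n.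
exact/has_lbound_sdrop/bounded_fun_has_lbound.
Qed.

Lemma le_limn_inf u K c N : (forall n, `|u n| <= K) ->
  (forall n, (N <= n)%N -> c <= u n) -> c <= limn_inf u.
Proof.
move=> uK cu; have bu := normr_le_bounded_fun uK.
rewrite limn_infE//; apply: (@le_trans _ _ (infs u N)).
  by apply: lb_le_inf; [exists (u N), N => /=|move=> _ [n /= Nn <-]; exact: cu].
apply: ub_le_sup; last by exists N.
exact: bounded_fun_has_ubound_infs.
Qed.

Lemma limn_inf_bounded u K : (forall n, `|u n| <= K) -> `|limn_inf u| <= K.
Proof.
move=> uK; rewrite ler_norml (le_limn_inf (N := 0) uK)/=; last first.
  by move=> n _; have := uK n; rewrite ler_norml => /andP[].
rewrite leNgt; apply/negP => /(lt_limn_inf uK)[N /(_ N (leqnn N))].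
by rewrite ltNge (le_trans (ler_norm _) (uK N)).
Qed.

(** The limit superior of [u] is always handled as minus the limit inferior of [- u]. This is liminf
    <= limsup in that form; [limn_inf_cvg] treats the case of equality. *)
Lemma limn_infD_opp_le0 u K : (forall n, `|u n| <= K) ->
  limn_inf u + limn_inf (fun n => - u n) <= 0.
Proof.
move=> uK; have nuK n : `|- u n| <= K by rewrite normrN.
rewrite leNgt; apply/negP => h.
pose e := (limn_inf u + limn_inf (fun n => - u n)) / 2.
have e0 : 0 < e by rewrite divr_gt0.
have [|N1 h1] := @lt_limn_inf u K (limn_inf u - e) uK; first by lra.
have [|N2 h2] := @lt_limn_inf _ K (limn_inf (fun n => - u n) - e) nuK; first by lra.
have := h1 (maxn N1 N2) (leq_maxl _ _); have := h2 (maxn N1 N2) (leq_maxr _ _).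
rewrite /e; lra.
Qed.

Lemma limn_inf_cvg u K : (forall n, `|u n| <= K) ->
  limn_inf u + limn_inf (fun n => - u n) = 0 -> u @ \oo --> limn_inf u.
Proof.
move=> uK h; have nuK n : `|- u n| <= K by rewrite normrN.
apply/cvgrPdist_le => e e0.
have [|N1 h1] := @lt_limn_inf u K (limn_inf u - e) uK; first by lra.
have [|N2 h2] := @lt_limn_inf _ K (limn_inf (fun n => - u n) - e) nuK; first by lra.
exists (maxn N1 N2) => // n /=; rewrite geq_max => /andP[/h1 ? /h2 ?].
by rewrite ler_norml; apply/andP; split; lra.
Qed.

End LimInf.

Definition bounded_mfun {R : realType} {d} {T : measurableType d} (f : T -> R) :=
  measurable_fun [set: T] f /\ exists K : R, forall w, `|f w| <= K.

Section BoundedMfun.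
Context {R : realType} {d} {T : measurableType d}.
Implicit Types f g : T -> R.

Lemma bounded_mfun_cst (c : R) : bounded_mfun (fun _ : T => c).
Proof. by split; [exact: measurable_cst|exists `|c|]. Qed.

Lemma bounded_mfunD f g : bounded_mfun f -> bounded_mfun g ->
  bounded_mfun (fun w => f w + g w).
Proof.
move=> [mf [K fK]] [mg [L gL]]; split; first exact: measurable_funD.
by exists (K + L) => w; rewrite (le_trans (ler_normD _ _))// lerD.
Qed.

Lemma bounded_mfunN f : bounded_mfun f -> bounded_mfun (fun w => - f w).
Proof.
move=> [mf [K fK]]; split; first exact: measurable_funN.
by exists K => w; rewrite normrN.
Qed.

Lemma bounded_mfunB f g : bounded_mfun f -> bounded_mfun g ->
  bounded_mfun (fun w => f w - g w).
Proof. by move=> bf bg; exact: bounded_mfunD bf (bounded_mfunN bg). Qed.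

Lemma bounded_mfunZ (c : R) f : bounded_mfun f -> bounded_mfun (fun w => c * f w).
Proof.
move=> [mf [K fK]]; split; first by apply: measurable_funM => //; exact: measurable_cst.
by exists (`|c| * K) => w; rewrite normrM ler_wpM2l.
Qed.

Lemma bounded_mfun_comp f (phi : T -> T) : measurable_fun [set: T] phi ->
  bounded_mfun f -> bounded_mfun (fun w => f (phi w)).
Proof.
move=> mphi [mf [K fK]]; split; first exact: measurableT_comp mf mphi.
by exists K.
Qed.

Lemma bounded_mfun_indic (A : set T) : measurable A -> bounded_mfun (\1_A : T -> R).
Proof.
move=> mA; split; first exact: measurable_indic.
by exists 1 => w; rewrite indicE; case: (w \in A); rewrite ?normr1// normr0.
Qed.

Lemma bounded_mfun_sum n (F : nat -> T -> R) : (forall k, bounded_mfun (F k)) ->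
  bounded_mfun (fun w => \sum_(k < n) F k w).
Proof.
move=> bF; elim: n => [|n IHn].
  by under eq_fun do rewrite big_ord0; exact: bounded_mfun_cst.
by under eq_fun do rewrite big_ord_recr; exact: bounded_mfunD.
Qed.

Lemma measurable_iter (phi : T -> T) n : measurable_fun [set: T] phi ->
  measurable_fun [set: T] (iter n phi).
Proof.
move=> mphi; elim: n => [|n IHn]; first exact: measurable_id.
exact: (measurableT_comp mphi IHn).
Qed.

End BoundedMfun.

Section Expectation.
Context {R : realType} {d} {T : measurableType d} (P : probability T R).
Implicit Types f g : T -> R.

Definition mean f : R := \int[P]_w f w.

Lemma bounded_mfun_integrable f : bounded_mfun f ->
  P.-integrable [set: T] (EFin \o f).
Proof.
move=> [mf [K fK]]; apply: measurable_bounded_integrable => //.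
  by apply: le_lt_trans (probability_le1 P measurableT) _; rewrite ltry.
exists K; split; first exact: num_real.
by move=> M KM w _; apply: le_trans (fK w) _; exact: ltW.
Qed.

(** Gives a point at which to evaluate the bounds on a process, whence [0 <= lam]. *)
Lemma probability_setT_nonempty : [set: T] !=set0.
Proof.
apply/set0P/eqP => T0; have := probability_setT P.
by rewrite [X in P X]T0 measure0 => /eqP; rewrite eq_sym onee_eq0.
Qed.

Lemma mean_cst c : mean (fun _ => c) = c.
Proof.
have h : (P : {measure set T -> \bar R}) [set: T] = 1%E := probability_setT P.
by rewrite /mean Rintegral_cst// h mulr1.
Qed.

Lemma meanD f g : bounded_mfun f -> bounded_mfun g ->
  mean (fun w => f w + g w) = mean f + mean g.
Proof. by move=> bf bg; apply: RintegralD => //; exact: bounded_mfun_integrable. Qed.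

Lemma meanZ c f : bounded_mfun f -> mean (fun w => c * f w) = c * mean f.
Proof. by move=> bf; apply: RintegralZl => //; exact: bounded_mfun_integrable. Qed.

Lemma meanN f : bounded_mfun f -> mean (fun w => - f w) = - mean f.
Proof. by move=> bf; under eq_fun do rewrite -mulN1r; rewrite meanZ// mulN1r. Qed.

Lemma le_mean f g : bounded_mfun f -> bounded_mfun g ->
  (forall w, f w <= g w) -> mean f <= mean g.
Proof. by move=> bf bg fg; apply: le_Rintegral => //; exact: bounded_mfun_integrable. Qed.

Lemma mean_indic A : measurable A -> mean \1_A = fine (P A).
Proof. by move=> mA; rewrite /mean /Rintegral integral_indic// setIT. Qed.

Lemma mean_sum n (F : nat -> T -> R) : (forall k, bounded_mfun (F k)) ->
  mean (fun w => \sum_(k < n) F k w) = \sum_(k < n) mean (F k).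
Proof.
move=> bF; elim: n => [|n IHn].
  by under eq_fun do rewrite big_ord0; rewrite mean_cst big_ord0.
under eq_fun do rewrite big_ord_recr/=.
by rewrite meanD ?IHn ?big_ord_recr//; exact: bounded_mfun_sum.
Qed.

(** Turns comparisons of means into almost everywhere equalities; both [orbit_limit_ae] and
    [kingman] rest on it. *)
Lemma ge0_mean_le0_ae f : bounded_mfun f -> (forall w, 0 <= f w) ->
  mean f <= 0 -> {ae P, forall w, f w = 0}.
Proof.
move=> bf f0 mf0.
have intf := bounded_mfun_integrable bf.
have : (\int[P]_(w in [set: T]) `|(EFin \o f) w| = 0)%E.
  under eq_integral do rewrite /= ger0_norm//.
  rewrite -[LHS]fineK; last exact: integrable_fin_num.
  congr EFin; apply/eqP; rewrite eq_le mf0/=; exact: Rintegral_ge0.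
move/(ae_eq_integral_abs P measurableT); case: (bf) => /measurable_EFinP mf _.
move=> /(_ mf); apply: filterS => w /= /(_ I).
by case.
Qed.

End Expectation.

(** Transfers measurability from limits superior to limits inferior. *)
Lemma limn_infE_limn_sup {R : realType} (u : nat -> R) K : (forall n, `|u n| <= K) ->
  limn_inf u = - limn_sup (fun n => - u n).
Proof.
move=> uK; have bu := normr_le_bounded_fun uK.
have bnu : bounded_fun (fun n => - u n).
  by apply: (@normr_le_bounded_fun _ _ K) => n; rewrite normrN.
rewrite limn_infE// limn_supE// /inf opprK; congr sup.
have -> : sups (fun n => - u n) = - infs u := supsN u.
apply/seteqP; split => x /=.
  by move=> [n _ <-]; exists (- infs u n); rewrite ?opprK//; exists n.
by move=> [_ [n _ <-] <-]; exists n => //; rewrite opprK.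
Qed.

Lemma bounded_mfun_limn_inf {R : realType} {d} {T : measurableType d}
    (h : nat -> T -> R) K : (forall n, measurable_fun [set: T] (h n)) ->
  (forall n w, `|h n w| <= K) -> bounded_mfun (fun w => limn_inf (h ^~ w)).
Proof.
move=> mh hK; split; last by exists K => w; apply: limn_inf_bounded => n.
under eq_fun do rewrite (limn_infE_limn_sup (hK ^~ _)).
apply: measurable_funN; apply: measurable_fun_limn_sup.
- move=> w _; exists K => _ [n _ <-].
  by rewrite (le_trans (ler_norm _))// normrN.
- move=> w _; exists (- K) => _ [n _ <-].
  by rewrite lerN2 (le_trans (ler_norm _)).
- by move=> n; exact: measurable_funN.
Qed.

(** * Invariant probabilities and limits along orbits *)

Section Invariance.
Context {R : realType} {d} {T : measurableType d} (P : probability T R).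
Variable tau : T -> T.
Hypothesis mtau : measurable_fun [set: T] tau.
Hypothesis invP : invariant_probabilities tau P.
Implicit Types f g : T -> R.

(** Change of variables: the pushforward of [P] along [tau] agrees with [P] on measurable sets. *)
Lemma mean_comp f : bounded_mfun f -> mean P (fun w => f (tau w)) = mean P f.
Proof.
move=> bf; rewrite /mean /Rintegral; congr fine.
transitivity (\int[pushforward P tau]_y (f y)%:E)%E; last first.
  by apply: eq_measure_integral => A mA _; exact/esym/invP.
rewrite integral_pushforward ?preimage_setT//.
  by apply/measurable_EFinP; case: bf.
by apply: (@bounded_mfun_integrable _ _ _ P (f \o tau)); exact: bounded_mfun_comp.
Qed.

Lemma mean_comp_iter f n : bounded_mfun f ->
  mean P (fun w => f (iter n tau w)) = mean P f.
Proof.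
move=> bf; elim: n => [//|n IHn]; rewrite -[RHS]IHn.
under eq_fun do rewrite iterSr.
apply: (mean_comp (f := fun w => f (iter n tau w))).
exact/bounded_mfun_comp/bf/measurable_iter.
Qed.

(* The increasing limit of f along orbits: a strictly invariant version of a
   function which only satisfies [f <= f \o tau]. *)
Definition orbit_limit f w := limn (fun k => f (iter k tau w)).

Variables (f : T -> R) (K : R).
Hypothesis mf : measurable_fun [set: T] f.
Hypothesis fK : forall w, `|f w| <= K.
Hypothesis ftau : forall w, f w <= f (tau w).

Let f_iter_ndecr w : nondecreasing_seq (fun k => f (iter k tau w)).
Proof. by apply/nondecreasing_seqP => k /=; exact: ftau. Qed.

Let f_iter_cvg w : cvgn (fun k => f (iter k tau w)).
Proof.
apply: nondecreasing_is_cvgn => //; exists K => _ [k _ <-].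
by rewrite (le_trans (ler_norm _)).
Qed.

Lemma orbit_limit_comp w : orbit_limit f (tau w) = orbit_limit f w.
Proof.
apply/cvg_lim => //; under eq_cvg do rewrite -iterSr.
by have := @f_iter_cvg w; rewrite -(cvg_shiftS (fun k => f (iter k tau w))).
Qed.

Lemma orbit_limit_bounded w : `|orbit_limit f w| <= K.
Proof.
rewrite ler_norml; apply/andP; split.
  apply: limr_ge => //; apply: nearW => k.
  by have := fK (iter k tau w); rewrite ler_norml => /andP[].
by apply: limr_le => //; apply: nearW => k; rewrite (le_trans (ler_norm _)).
Qed.

Lemma measurable_orbit_limit : measurable_fun [set: T] (orbit_limit f).
Proof.
apply: (measurable_fun_cvg (h := fun k w => f (iter k tau w))).
  by move=> k; apply: (measurableT_comp mf); exact: measurable_iter.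
by move=> w _; exact: f_iter_cvg.
Qed.

(** The difference of [f \o tau^k] and [f] is nonnegative and has mean 0 by invariance, so it
    vanishes almost everywhere. Off one null set this holds for all [k], and the orbit sequence is
    constant. *)
Lemma orbit_limit_ae : {ae P, forall w, f w = orbit_limit f w}.
Proof.
have bf : bounded_mfun f by split => //; exists K.
have : {ae P, forall w, forall k, f (iter k tau w) - f w = 0}.
  apply: ae_foralln => k.
  have bfk : bounded_mfun (fun w => f (iter k tau w)).
    exact/bounded_mfun_comp/bf/measurable_iter.
  apply: ge0_mean_le0_ae; first exact: bounded_mfunB.
    by move=> w; rewrite subr_ge0; exact: (@f_iter_ndecr w _ _ (leq0n k)).
  by rewrite (meanD P bfk (bounded_mfunN bf)) meanN// mean_comp_iter// subrr.
apply: filterS => w fw; apply/esym/cvg_lim => //.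
by under eq_cvg do rewrite (subr0_eq (fw _)); exact: cvg_cst.
Qed.

End Invariance.

(** * Kingman's theorem *)

(** The case [n = 0] is included, where the quotient is 0 by convention, so that rates are bounded
    at every index although [S 0] is a dummy value. *)
Lemma normr_rate_le {R : realType} (n : nat) (lam x : R) : 0 <= lam ->
  ((0 < n)%N -> - lam * n%:R <= x <= lam * n%:R) -> `|x / n%:R| <= lam.
Proof.
move=> lam0; case: n => [_|n]; first by rewrite invr0 mulr0 normr0.
move=> /(_ isT) /andP[xl xu]; rewrite normrM [X in _ * X]ger0_norm ?invr_ge0//.
by rewrite ler_pdivrMr// ler_norml -mulNr xl.
Qed.

Definition lower_rate {R : realType} {T : Type} (S : nat -> T -> R) (w : T) : R :=
  limn_inf (fun n => S n w / n%:R).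

Section Kingman.
Context {R : realType} {d} {T : measurableType d}.
Variable tau : T -> T.
Hypothesis mtau : measurable_fun [set: T] tau.
Implicit Types (S : nat -> T -> R) (lam e : R).

Definition birkhoff_sum (a : T -> R) (n : nat) (w : T) : R :=
  \sum_(k < n) a (iter k tau w).

Definition bounded_process lam S := forall n, (0 < n)%N ->
  measurable_fun [set: T] (S n) /\ forall w, - lam * n%:R <= S n w <= lam * n%:R.

Lemma bounded_processN lam S :
  bounded_process lam S -> bounded_process lam (fun n w => - S n w).
Proof.
move=> bS n n0; have [mS hS] := bS _ n0; split; first exact: measurable_funN.
by move=> w; rewrite lerNr mulNr opprK andbC lerNl -mulNr.
Qed.

Definition bad_set S (g : T -> R) e N : set T :=
  \bigcap_(n in [set n | (0 < n <= N)%N]) [set w | n%:R * (g w + e) < S n w].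

Lemma measurable_bad_set lam S g e N : bounded_process lam S ->
  measurable_fun [set: T] g -> measurable (bad_set S g e N).
Proof.
move=> bS mg; apply: bigcap_measurableType => n /= /andP[n0 _].
rewrite -[X in measurable X]setTI; apply: measurable_fun_ltr => //.
  apply: measurable_funM => //; exact: measurable_funD.
by have [] := bS _ n0.
Qed.

Lemma bounded_mfun_birkhoff_sum (a : T -> R) n :
  bounded_mfun a -> bounded_mfun (birkhoff_sum a n).
Proof.
move=> ba; apply: (@bounded_mfun_sum _ _ _ _ (fun k w => a (iter k tau w))) => k.
exact/bounded_mfun_comp/ba/measurable_iter.
Qed.

Lemma bounded_process_birkhoff_sum (a : T -> R) lam : measurable_fun [set: T] a ->
  (forall w, `|a w| <= lam) -> bounded_process lam (birkhoff_sum a).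
Proof.
move=> ma alam n _; split.
  by have [] := @bounded_mfun_birkhoff_sum a n (conj ma (ex_intro _ lam alam)).
move=> w; rewrite mulNr -ler_norml; apply: (le_trans (ler_norm_sum _ _ _)).
rewrite mulr_natr -[X in _ *+ X](card_ord n) -sumr_const.
by apply: ler_sum => k _.
Qed.

Lemma birkhoff_sum_add a n k w :
  birkhoff_sum a (n + k) w = birkhoff_sum a n w + birkhoff_sum a k (iter n tau w).
Proof.
rewrite /birkhoff_sum big_split_ord/=; congr (_ + _).
by apply: eq_bigr => i _; rewrite addnC iterD.
Qed.

Lemma lower_rate_bounded lam S w : 0 <= lam -> bounded_process lam S ->
  forall n, `|S n w / n%:R| <= lam.
Proof. by move=> lam0 bS n; apply: normr_rate_le => // /bS[_ /(_ w)]. Qed.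

Lemma bounded_mfun_lower_rate lam S : 0 <= lam -> bounded_process lam S ->
  bounded_mfun (lower_rate S).
Proof.
move=> lam0 bS; apply: (@bounded_mfun_limn_inf _ _ _ (fun n w => S n w / n%:R) lam).
  case=> [|n]; last first.
    apply: measurable_funM; last exact: measurable_cst.
    by have [] := bS n.+1 isT.
  by under eq_fun do rewrite invr0 mulr0; exact: measurable_cst.
by move=> n w; exact: lower_rate_bounded.
Qed.

Section Subadditive.
Variables (S : nat -> T -> R) (lam : R).
Hypothesis lam0 : 0 <= lam.
Hypothesis bS : bounded_process lam S.
Hypothesis subS : subadditive_process tau S.

Let rate_le n w : `|S n w / n%:R| <= lam.
Proof. exact: lower_rate_bounded. Qed.

(** Divide S_(n+1)(w) <= S_1(w) + S_n(tau w) by n: the bounded term S_1 does not count in the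
    limit. *)
Lemma lower_rate_le_comp w : lower_rate S w <= lower_rate S (tau w).
Proof.
rewrite leNgt; apply/negP => h.
(* A third of the supposed gap: the loss of [2 * e] below still contradicts it. *)
pose e := (lower_rate S w - lower_rate S (tau w)) / 3.
have e0 : 0 < e by rewrite divr_gt0// subr_gt0.
have [|N1 h1] := @lt_limn_inf _ _ lam (lower_rate S w - e) (rate_le ^~ w).
  by rewrite -/(lower_rate S w); lra.
(* From [N2] on, [n * e] pays for S_1 and for passing from n + 1 to n. *)
have [N2 N2h] : exists N2, (lam - (lower_rate S w - e)) / e <= N2%:R.
  exists (Num.truncn ((lam - (lower_rate S w - e)) / e)).+1.
  exact/ltW/truncnS_gt.
pose N := (maxn N1 N2).+1.
suff : lower_rate S w - 2 * e <= lower_rate S (tau w) by rewrite /e; lra.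
apply: (@le_limn_inf _ _ lam _ N) => // n Nn.
have n0 : (0 < n)%N by apply: leq_trans Nn.
have [N1n N2n] : (N1 <= n.+1)%N /\ (N2 <= n)%N.
  by move: Nn; rewrite gtn_max => /andP[/ltnW/leqW ? /ltnW ?].
have := h1 _ N1n; rewrite ltr_pdivlMr ?ltr0n// => hS.
have := @subS 1 n isT n0 w; rewrite add1n /= => hsub.
have [_ /(_ w)] := @bS 1 isT; rewrite !mulr1 => /andP[_ S1].
have : (lam - (lower_rate S w - e)) <= n%:R * e.
  by rewrite -ler_pdivrMr// (le_trans N2h)// ler_nat.
rewrite ler_pdivlMr ?ltr0n//; move: hS; rewrite -natr1 => hS ?.
lra.
Qed.

(** * The covering inequality *)

Section Covering.
Variables (g : T -> R) (e : R) (N : nat).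
Hypothesis gtau : forall w, g (tau w) = g w.
Hypothesis glam : forall w, `|g w| <= lam.
Hypothesis e0 : 0 <= e.

Let B := bad_set S g e N.

Let glb w : - lam <= g w.
Proof. by have := glam w; rewrite ler_norml => /andP[]. Qed.

Let g_iter n w : g (iter n tau w) = g w.
Proof. by elim: n => //= n <-. Qed.

Let sum_ge0 n w : 0 <= birkhoff_sum (\1_B : T -> R) n w.
Proof. by apply: sumr_ge0 => k _; rewrite indicE. Qed.

(* Cut the orbit segment greedily: from a point outside B some S n with n <= N
   is at most n (g + e); a point of B is skipped at the cost of 2 lam. *)
Lemma subadditive_covering m w : (0 < m)%N ->
  S m w <= m%:R * (g w + e) + 2 * lam * birkhoff_sum (\1_B : T -> R) m w
           + 2 * lam * N%:R.
Proof.
elim/ltn_ind: m w => m IHm w m0.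
have [lam_ge0 e_ge0] := (lam0, e0).
have lamN : 0 <= lam * N%:R by rewrite mulr_ge0.
(* At a point of [B] take one step: [S 1 <= lam] and [g >= - lam], so the excess over [g] is at most
   [2 * lam], which the indicator pays. *)
have [Bw|nBw] := pselect (B w).
  have S1 : S 1 w <= lam by have [_ /(_ w)] := @bS 1 isT; rewrite !mulr1 => /andP[_].
  have B1 : birkhoff_sum (\1_B : T -> R) 1 w = 1.
    by rewrite /birkhoff_sum big_ord1 indicE mem_set.
  have gw := glb w.
  case: m m0 IHm => [//|[_ _|m _ IHm]]; first by rewrite B1; lra.
  have := @subS 1 m.+1 isT isT w; have := IHm _ (ltnSn _) (tau w) isT.
  rewrite (birkhoff_sum_add _ 1 m.+1) add1n B1 /= gtau -[m.+2%:R]natr1; lra.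
have [n /andP[n0 nN] Sn] : exists2 n, (0 < n <= N)%N & S n w <= n%:R * (g w + e).
  apply: contrapT => h; apply: nBw => n /= nN; rewrite ltNge; apply/negP => ?.
  by apply: h; exists n.
have [nm|mn] := ltnP n m.
  have mn0 : (0 < m - n)%N by rewrite subn_gt0.
  have := @subS n (m - n)%N n0 mn0 w.
  have : (m - n < m)%N by rewrite ltn_subrL n0.
  move=> /IHm/(_ (iter n tau w) mn0); rewrite g_iter.
  have -> : birkhoff_sum (\1_B : T -> R) m w = birkhoff_sum \1_B n w +
      birkhoff_sum \1_B (m - n) (iter n tau w).
    by rewrite -birkhoff_sum_add subnKC// ltnW.
  rewrite (subnKC (ltnW nm)) natrB ?(ltnW nm)//.
  have : 0 <= 2 * lam * birkhoff_sum (\1_B : T -> R) n w by rewrite !mulr_ge0.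
  lra.
(* The remaining segment has length [m <= n <= N]; the crude bound [lam * m] exceeds [m * g] by at
   most [2 * lam * N]. *)
have [_ /(_ w) /andP[_ Sm]] := @bS m m0.
have : lam * m%:R <= lam * N%:R by rewrite ler_wpM2l// ler_nat (leq_trans mn).
have : 0 <= m%:R * (lam + g w) by rewrite mulr_ge0// -lerBlDl sub0r.
have : 0 <= m%:R * e by rewrite mulr_ge0.
have : 0 <= 2 * lam * birkhoff_sum (\1_B : T -> R) m w by rewrite !mulr_ge0.
lra.
Qed.

(** Negate the covering inequality, divide by m and take limits inferior; the boundary term 2 lam N
    / m disappears. *)
Lemma lower_rate_opp_ge w :
  - (g w + e) + 2 * lam * lower_rate (birkhoff_sum (fun x => - (\1_B x : R))) w
    <= lower_rate (fun n x => - S n x) w.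
Proof.
set c := lower_rate (birkhoff_sum _) w; set r := lower_rate _ w.
have lam1 : 0 < 2 * lam + 1 by rewrite ltr_wpDl// mulr_ge0.
apply/ler_addgt0Pl => eta eta0.
(* The share [2 * lam * del] of [eta] pays for approaching the limit inferior [c], the share [del]
   for the boundary term. Adding 1 keeps the denominator positive when [lam = 0]. *)
pose del := eta / (2 * lam + 1); have del0 : 0 < del by rewrite divr_gt0.
have etaE : eta = 2 * lam * del + del.
  by rewrite -[X in _ + X]mul1r -mulrDl /del mulrCA divff ?mulr1// gt_eqF.
have avg_le n : `|birkhoff_sum (fun x => - (\1_B x : R)) n w / n%:R| <= 1.
  apply: normr_rate_le => // _; rewrite /birkhoff_sum sumrN mulN1r mul1r.
  apply/andP; split; last by
    rewrite (@le_trans _ _ 0)// oppr_le0 sumr_ge0// => k _; rewrite indicE.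
  rewrite lerN2 -[X in _ <= X%:R](card_ord n) -sumr_const.
  by apply: ler_sum => k _; rewrite indicE; case: (_ \in _).
have [|N1 h1] := @lt_limn_inf _ _ 1 (c - del) avg_le;
  first by rewrite ltrBlDr; apply: (_ : c < c + del); lra.
pose N2 := (Num.truncn (2 * lam * N%:R / del)).+1.
have N2h : 2 * lam * N%:R <= N2%:R * del by rewrite -ler_pdivrMr// ltW// truncnS_gt.
rewrite -lerBlDl.
apply: (@le_limn_inf _ _ lam _ (maxn N1 N2)) => [n|n].
  by rewrite mulNr normrN.
rewrite geq_max => /andP[/h1 hn1 N2n].
have n0 : (0 < n)%N by exact: leq_trans N2n.
rewrite ler_pdivlMr ?ltr0n//.
move: hn1; rewrite ltr_pdivlMr ?ltr0n// => hn1.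
have := subadditive_covering w n0.
have -> : birkhoff_sum (\1_B : T -> R) n w =
    - birkhoff_sum (fun x => - (\1_B x : R)) n w.
  by rewrite /birkhoff_sum sumrN opprK.
have : 2 * lam * ((c - del) * n%:R) <=
    2 * lam * birkhoff_sum (fun x => - (\1_B x : R)) n w.
  by rewrite ler_wpM2l ?mulr_ge0// ltW.
have : N2%:R * del <= n%:R * del by rewrite ler_wpM2r// ?ler_nat// ltW.
have : eta * n%:R = 2 * lam * del * n%:R + n%:R * del by rewrite etaE; ring.
move: N2h; lra.
Qed.

End Covering.

(** A point bad for every [N] has S_n / n > g + e for all n >= 1, hence lower rate at least g +
    e. *)
Lemma bad_set_eventually g e w : 0 < e -> lower_rate S w = g w ->
  ~ (\bigcap_N bad_set S g e N) w.
Proof.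
move=> e0 Sg h.
suff : g w + e <= lower_rate S w by rewrite Sg; lra.
apply: (@le_limn_inf _ _ lam _ 1) => // n n0; apply: ltW.
rewrite ltr_pdivlMr ?ltr0n// mulrC.
by have := h n I n; apply; rewrite /= n0 leqnn.
Qed.

Section Invariant.
Variable P : probability T R.
Hypothesis invP : invariant_probabilities tau P.

Let g := orbit_limit tau (lower_rate S).

Let rate_bounded w : `|lower_rate S w| <= lam.
Proof. exact: limn_inf_bounded. Qed.

Let mrate : measurable_fun [set: T] (lower_rate S).
Proof. by have [] := bounded_mfun_lower_rate lam0 bS. Qed.

Let glam w : `|g w| <= lam.
Proof. exact: (orbit_limit_bounded rate_bounded lower_rate_le_comp). Qed.

Let gtau w : g (tau w) = g w.
Proof. exact: (orbit_limit_comp rate_bounded lower_rate_le_comp). Qed.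

Let mg : measurable_fun [set: T] g.
Proof. exact: (measurable_orbit_limit mtau mrate rate_bounded lower_rate_le_comp). Qed.

Let bg : bounded_mfun g. Proof. by split => //; exists lam. Qed.

Let gE : {ae P, forall w, lower_rate S w = g w}.
Proof. exact: (orbit_limit_ae mtau invP mrate rate_bounded lower_rate_le_comp). Qed.

Let mB e N : measurable (bad_set S g e N).
Proof. exact: measurable_bad_set bS mg. Qed.

Lemma mean_lower_rate : mean P (lower_rate S) = mean P g.
Proof.
rewrite /mean /Rintegral; congr fine; apply: ae_eq_integral => //.
- exact/measurable_EFinP.
- exact/measurable_EFinP.
- by apply: filterS gE => w gw _; rewrite gw.
Qed.

(** Continuity from above: the bad sets decrease in [N] and their intersection is null, because the
    lower rate equals [g] almost everywhere. *)
Lemma probability_bad_set e del : 0 < e -> 0 < del ->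
  exists N, fine (P (bad_set S g e N)) <= del.
Proof.
move=> e0 del0.
have : (P \o bad_set S g e) N @[N --> \oo] --> P (\bigcap_N bad_set S g e N).
  apply: nonincreasing_cvg_mu => //.
  - by apply: le_lt_trans (probability_le1 P (mB e 0)) _; rewrite ltry.
  - exact: bigcapT_measurable.
  - move=> m n mn; apply/subsetPset => w h k /= /andP[k0 km]; apply: h => /=.
    by rewrite k0 (leq_trans km).
have -> : P (\bigcap_N bad_set S g e N) = 0%E.
  have [A [mA PA0 sA]] := gE.
  apply/eqP; rewrite eq_le measure_ge0 andbT -PA0; apply: le_measure.
  - by rewrite inE; exact: bigcapT_measurable.
  - by rewrite inE.
  - move=> w hw; apply: sA => /= Sg; exact: (bad_set_eventually e0 Sg hw).
move=> /fine_cvgP[_ /cvgrPdist_le /(_ _ del0)] [N _ /(_ N (leqnn N))] /=.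
rewrite sub0r normrN => h; exists N; exact: le_trans (ler_norm _) h.
Qed.

(** The covering inequality integrated: by invariance each of the [m] indicators along the orbit
    contributes the probability of the bad set. *)
Lemma mean_subadditive_le e N m : 0 <= e -> (0 < m)%N ->
  mean P (S m) <= m%:R * (mean P g + e)
    + 2 * lam * (m%:R * fine (P (bad_set S g e N))) + 2 * lam * N%:R.
Proof.
move=> e0 m0.
have b1 : bounded_mfun (\1_(bad_set S g e N) : T -> R) by exact: bounded_mfun_indic.
have bb : bounded_mfun (birkhoff_sum (\1_(bad_set S g e N) : T -> R) m).
  exact: bounded_mfun_birkhoff_sum.
have bge : bounded_mfun (fun w => g w + e) by exact/bounded_mfunD/bounded_mfun_cst.
have bSm : bounded_mfun (S m).
  have [mS hS] := bS m0; split => //; exists (lam * m%:R) => w.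
  by rewrite ler_norml -mulNr.
have -> : m%:R * fine (P (bad_set S g e N)) =
    mean P (birkhoff_sum (\1_(bad_set S g e N) : T -> R) m).
  rewrite (mean_sum P m (F := fun k w => \1_(bad_set S g e N) (iter k tau w))).
    under eq_bigr do rewrite mean_comp_iter// mean_indic//.
    by rewrite sumr_const card_ord mulr_natl.
  by move=> k; exact/bounded_mfun_comp/b1/measurable_iter.
have b12 := bounded_mfunD (bounded_mfunZ m%:R bge) (bounded_mfunZ (2 * lam) bb).
have b3 := bounded_mfun_cst (T := T) (2 * lam * N%:R).
rewrite -[X in _ * (_ + X)](mean_cst P) -meanD//; last exact: bounded_mfun_cst.
rewrite -!meanZ// -[X in _ + X](mean_cst P) -meanD//; [|exact: bounded_mfunZ..].
rewrite -meanD//; apply: le_mean => //; first exact: bounded_mfunD.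
by move=> w /=; apply: subadditive_covering.
Qed.

End Invariant.
End Subadditive.

(** * Almost everywhere convergence for an invariant probability *)

Section KingmanTheorem.
Variable P : probability T R.
Hypothesis invP : invariant_probabilities tau P.

Lemma birkhoff_sum_subadditive (a : T -> R) : subadditive_process tau (birkhoff_sum a).
Proof. by move=> n k _ _ w; rewrite birkhoff_sum_add. Qed.

(** For additive S the mean of S_m is m times that of [a], so dividing the integrated covering
    inequality by a large m gives the bound. *)
Lemma mean_le_lower_rate (a : T -> R) : bounded_mfun a ->
  mean P a <= mean P (lower_rate (birkhoff_sum a)).
Proof.
move=> ba; have [ma [lam alam]] := ba.
have [w0 _] := probability_setT_nonempty P.
have lam0 : 0 <= lam by exact: le_trans (normr_ge0 _) (alam w0).
have bS := bounded_process_birkhoff_sum ma alam.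
have subS := @birkhoff_sum_subadditive a.
rewrite (mean_lower_rate lam0 bS subS invP).
set g := orbit_limit _ _.
apply/ler_addgt0Pl => e e0.
(* One half of [e] is the slack in the bad set, the other bounds [2 * lam] times its probability. *)
pose e1 := e / 2; pose e2 := e1 / (2 * lam + 1).
have e10 : 0 < e1 by rewrite divr_gt0.
have l1 : 0 < 2 * lam + 1 by rewrite ltr_wpDl// mulr_ge0.
have e20 : 0 < e2 by rewrite divr_gt0.
have [N hN] := probability_bad_set lam0 bS subS invP e10 e20.
rewrite -/g in hN.
have h : 2 * lam * fine (P (bad_set (birkhoff_sum a) g e1 N)) <= e1.
  rewrite (@le_trans _ _ ((2 * lam + 1) * e2))//; last first.
    by rewrite /e2 mulrCA divff ?mulr1// gt_eqF.
  by rewrite ler_pM// ?mulr_ge0// ?fine_ge0// lerDl.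
rewrite leNgt; apply/negP => hlt.
pose D := mean P a - (e + mean P g).
have D0 : 0 < D by rewrite subr_gt0.
(* With this [m] the boundary term [2 * lam * N] is less than [m] times the supposed excess [D]. *)
pose m := (Num.truncn (2 * lam * N%:R / D)).+1.
have hm : 2 * lam * N%:R < m%:R * D by rewrite -ltr_pdivrMr// truncnS_gt.
have := mean_subadditive_le lam0 bS subS invP N (ltW e10) (isT : (0 < m)%N).
rewrite -/g.
have -> : mean P (birkhoff_sum a m) = m%:R * mean P a.
  rewrite (mean_sum P m (F := fun k w => a (iter k tau w))).
    under eq_bigr do rewrite mean_comp_iter//.
    by rewrite sumr_const card_ord mulr_natl.
  by move=> k; exact/bounded_mfun_comp/ba/measurable_iter.
have : m%:R * (2 * lam * fine (P (bad_set (birkhoff_sum a) g e1 N))) <= m%:R * e1.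
  by rewrite ler_wpM2l.
have : m%:R * e = m%:R * e1 + m%:R * e1 by rewrite /e1; field.
move: hm; rewrite /D; lra.
Qed.

(** The sum of the lower rates of S and - S is liminf - limsup, hence at most 0. Once its mean is
    shown to be at least 0 it vanishes almost everywhere, which is convergence. *)
Theorem kingman lam S : 0 <= lam -> bounded_process lam S ->
  subadditive_process tau S ->
  {ae P, forall w,
    (S n w / n%:R) @[n --> \oo] --> orbit_limit tau (lower_rate S) w}.
Proof.
move=> lam0 bS subS.
have bSN := bounded_processN bS.
have rate_le w := lower_rate_bounded w lam0 bS.
have bu := bounded_mfun_lower_rate lam0 bS.
have bl := bounded_mfun_lower_rate lam0 bSN.
have lE w : lower_rate (fun n w => - S n w) w = limn_inf (fun n => - (S n w / n%:R)).
  by rewrite /lower_rate; under eq_fun do rewrite mulNr.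
have sum_le0 w : lower_rate S w + lower_rate (fun n w => - S n w) w <= 0.
  by rewrite lE; exact: limn_infD_opp_le0 (rate_le w).
have gE : {ae P, forall w, lower_rate S w = orbit_limit tau (lower_rate S) w}.
  apply: (orbit_limit_ae mtau invP (K := lam)).
  - by have [] := bu.
  - by move=> w; exact: limn_inf_bounded.
  - exact: (lower_rate_le_comp lam0 bS subS).
set g := orbit_limit _ _ in gE *.
have bg : bounded_mfun g.
  split.
    apply: (measurable_orbit_limit mtau (K := lam)); first by have [] := bu.
    - by move=> w; exact: limn_inf_bounded.
    - exact: (lower_rate_le_comp lam0 bS subS).
  exists lam; apply: orbit_limit_bounded.
  - by move=> w; exact: limn_inf_bounded.
  - exact: (lower_rate_le_comp lam0 bS subS).
suff : {ae P, forall w, - (lower_rate S w + lower_rate (fun n w => - S n w) w) = 0}.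
  apply: filterS2 gE => w <- /eqP; rewrite oppr_eq0 lE => /eqP.
  exact: limn_inf_cvg (rate_le w).
apply: ge0_mean_le0_ae; first exact/bounded_mfunN/bounded_mfunD.
  by move=> w; rewrite oppr_ge0.
rewrite meanN; last exact: bounded_mfunD.
rewrite meanD// (mean_lower_rate lam0 bS subS invP) -/g oppr_le0.
apply/ler_addgt0Pl => e e0.
pose e1 := e / 2; pose e2 := e1 / (2 * lam + 1).
have e10 : 0 < e1 by rewrite divr_gt0.
have l1 : 0 < 2 * lam + 1 by rewrite ltr_wpDl// mulr_ge0.
have e20 : 0 < e2 by rewrite divr_gt0.
have [N hN] := probability_bad_set lam0 bS subS invP e10 e20.
rewrite -/g in hN; set B := bad_set S g e1 N in hN.
have mB : measurable B by apply: (measurable_bad_set _ _ bS); case: bg.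
have h : 2 * lam * fine (P B) <= e1.
  rewrite (@le_trans _ _ ((2 * lam + 1) * e2))//; last first.
    by rewrite /e2 mulrCA divff ?mulr1// gt_eqF.
  by rewrite ler_pM// ?mulr_ge0// ?fine_ge0// lerDl.
have bB : bounded_mfun (fun x => - (\1_B x : R)).
  exact/bounded_mfunN/bounded_mfun_indic.
have bsB : bounded_mfun (lower_rate (birkhoff_sum (fun x => - (\1_B x : R)))).
  apply: (bounded_mfun_lower_rate ler01); apply: bounded_process_birkhoff_sum.
    by case: bB.
  by move=> w; rewrite normrN indicE; case: (_ \in _); rewrite ?normr1// normr0.
have bge : bounded_mfun (fun w => - (g w + e1)).
  exact/bounded_mfunN/bounded_mfunD/bounded_mfun_cst.
have : mean P (fun w => - (g w + e1) +
    2 * lam * lower_rate (birkhoff_sum (fun x => - (\1_B x : R))) w) <=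
    mean P (lower_rate (fun n w => - S n w)).
  apply: le_mean => //; first exact/bounded_mfunD/bounded_mfunZ.
  move=> w; apply: (lower_rate_opp_ge lam0 bS subS) => //; last exact: ltW.
  - move=> x; apply: orbit_limit_comp (lower_rate_le_comp lam0 bS subS) _.
    by move=> y; exact: limn_inf_bounded.
  - move=> x; apply: orbit_limit_bounded (lower_rate_le_comp lam0 bS subS) _.
    by move=> y; exact: limn_inf_bounded.
rewrite meanD//; last exact: bounded_mfunZ.
rewrite meanZ// meanN; last exact/bounded_mfunD/bounded_mfun_cst.
rewrite meanD//; last exact: bounded_mfun_cst.
rewrite mean_cst.
(* The inequality for additive processes, applied to minus the indicator of [B], bounds the mean of
   its lower rate below by minus the probability of [B]. *)
have := mean_le_lower_rate bB; rewrite meanN; last exact: bounded_mfun_indic.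
rewrite mean_indic// => hB.
have : 2 * lam * - fine (P B) <= 2 * lam *
    mean P (lower_rate (birkhoff_sum (fun x => - (\1_B x : R)))).
  by rewrite ler_wpM2l// mulr_ge0.
move: h; rewrite /e1; lra.
Qed.

End KingmanTheorem.
End Kingman.

(** * Integrals of survival functions *)

Section SurvivalIntegral.
Context {R : realType}.
Implicit Types (F G : R -> R) (K a b h : R).
Notation mu := (@lebesgue_measure R).

(* t |-> nu {f >= t} is such a function when a <= f <= b. *)
Definition survival a b F := [/\ nonincreasing_fun F,
  forall s, s < a -> F s = 1 & forall s, b < s -> F s = 0].

(** The Choquet integral as a functional of the level function alone, using that the whole space has
    capacity 1. *)
Definition survival_integral F : R :=
  \int[mu]_(t in `[0, +oo[) F t + \int[mu]_(t in `]-oo, 0]) (F t - 1).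

Lemma survival_range a b F s : survival a b F -> 0 <= F s <= 1.
Proof.
move=> [dF F1 F0].
(* [F] is evaluated one unit beyond [s] and the endpoints, since its values at the endpoints are not
   prescribed. *)
have [mb ms] : b <= Num.max b s /\ s <= Num.max b s by rewrite !le_max !lexx orbT.
have [na ns] : Num.min a s <= a /\ Num.min a s <= s by rewrite !ge_min !lexx orbT.
have <- : F (Num.max b s + 1) = 0 by apply: F0; lra.
have {2}<- : F (Num.min a s - 1) = 1 by apply: F1; lra.
by apply/andP; split; apply: dF; lra.
Qed.

Lemma survival_weaken a b a' b' F : a' <= a -> b <= b' ->
  survival a b F -> survival a' b' F.
Proof.
move=> aa bb [dF F1 F0]; split=> // s hs; first by apply: F1; exact: lt_le_trans aa.
by apply: F0; exact: le_lt_trans bb _.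
Qed.

Lemma nonincreasing_integrable F a b : nonincreasing_fun F ->
  mu.-integrable `[a, b] (EFin \o F).
Proof.
move=> dF; apply: measurable_bounded_integrable => //.
- by rewrite /= lebesgue_measure_itv/=; case: ifP => _; rewrite ltry.
- exact: nonincreasing_measurable.
exists (`|F a| + `|F b|); split; first exact: num_real.
move=> M hM x /=; rewrite in_itv/= => /andP[ax xb].
have [Fa Fb] := (dF _ _ ax, dF _ _ xb).
apply: le_trans (ltW hM); rewrite ler_norml.
have := lerNnormlW (lexx `|F b|); have := ler_norm (F a).
have := normr_ge0 (F a); have := normr_ge0 (F b).
by move=> *; apply/andP; split; lra.
Qed.

Lemma Rintegral_itv_cst a b c : a <= b -> \int[mu]_(t in `[a, b]) c = c * (b - a).
Proof.
move=> ab; rewrite Rintegral_cst//= lebesgue_measure_itv/= lte_fin.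
case: ltP => //= ba; have -> : b = a by apply/eqP; rewrite eq_le ba ab.
by rewrite subrr.
Qed.

Lemma Rintegral_itv_split F a b c : nonincreasing_fun F -> a <= b -> b <= c ->
  \int[mu]_(t in `[a, c]) F t =
  \int[mu]_(t in `[a, b]) F t + \int[mu]_(t in `[b, c]) F t.
Proof.
move=> dF ab bc; have iF := nonincreasing_integrable a c dF.
have := @Rintegral_itvB _ F (BLeft a) (BRight c) b iF.
rewrite !bnd_simp => /(_ ab bc) /eqP; rewrite subr_eq addrC => /eqP ->.
rewrite Rintegral_itv_obnd_cbnd//; apply: integrableS (nonincreasing_integrable b c dF) => //.
by apply: subset_itvr; rewrite bnd_simp.
Qed.

Lemma Rintegral_riemann F a h n : nonincreasing_fun F -> 0 <= h ->
  h * \sum_(j < n) F (a + j.+1%:R * h) <= \int[mu]_(t in `[a, a + n%:R * h]) F t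
  <= h * \sum_(j < n) F (a + j%:R * h).
Proof.
move=> dF h0; elim: n => [|n IHn].
  by rewrite !big_ord0 mul0r addr0 set_itv1 Rintegral_set1 mulr0 lexx.
have le1 : a <= a + n%:R * h by rewrite lerDl mulr_ge0.
have hE : a + n.+1%:R * h = a + n%:R * h + h by rewrite -natr1; ring.
have le2 : a + n%:R * h <= a + n.+1%:R * h by rewrite hE lerDl.
rewrite (Rintegral_itv_split dF le1 le2) !big_ord_recr !mulrDr/=.
have len : a + n.+1%:R * h - (a + n%:R * h) = h by rewrite hE addrC addKr.
have cstE c : h * c = \int[mu]_(t in `[a + n%:R * h, a + n.+1%:R * h]) c.
  by rewrite Rintegral_itv_cst// len mulrC.
have icst c : mu.-integrable `[a + n%:R * h, a + n.+1%:R * h] (EFin \o (fun=> c)).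
  exact: nonincreasing_integrable.
move: IHn => /andP[l u]; apply/andP; split; apply: lerD => //; rewrite cstE.
  apply: le_Rintegral => //; first exact: nonincreasing_integrable.
  by move=> x /=; rewrite in_itv/= => /andP[_ xu]; exact: dF.
apply: le_Rintegral => //; first exact: nonincreasing_integrable.
by move=> x /=; rewrite in_itv/= => /andP[xu _]; exact: dF.
Qed.

(** Both integrands vanish outside [- K, K], and the constant -1 on [- K, 0] contributes - K. *)
Lemma survival_integralE K F : 0 <= K -> survival (- K) K F ->
  survival_integral F = \int[mu]_(t in `[- K, K]) F t - K.
Proof.
move=> K0 sF; have [dF F1 F0] := sF; have NK0 : - K <= 0 by rewrite oppr_le0.
rewrite (Rintegral_itv_split dF NK0 K0) [X in _ = X - _]addrC -addrA; congr (_ + _).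
  have -> : `[0, K]%classic = `[0, +oo[%classic `&` `]-oo, K]%classic.
    by apply/seteqP; split=> x /=; rewrite !in_itv/= ?andbT;
      [move=> /andP[-> ->]|move=> [-> ->]].
  rewrite Rintegral_mkcondr; apply: eq_Rintegral => x _; rewrite patchE.
  by case: ifPn => // /negP; rewrite inE/= in_itv/= => /negP; rewrite -ltNge => /F0.
have -> : \int[mu]_(t in `]-oo, 0]) (F t - 1) = \int[mu]_(t in `[- K, 0]) (F t - 1).
  have -> : `[- K, 0]%classic = `]-oo, 0]%classic `&` `[- K, +oo[%classic.
    by apply/seteqP; split=> x /=; rewrite !in_itv/= ?andbT;
      [move=> /andP[-> ->]|move=> [-> ->]].
  rewrite Rintegral_mkcondr; apply: eq_Rintegral => x _; rewrite patchE.
  case: ifPn => // /negP; rewrite inE/= in_itv/= andbT => /negP; rewrite -ltNge.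
  by move=> /F1 ->; rewrite subrr.
rewrite RintegralB//; [|exact: nonincreasing_integrable..].
by rewrite Rintegral_itv_cst// mul1r sub0r opprK.
Qed.

Lemma ler_add_invn (x y c : R) : 0 <= c ->
  (forall n, (0 < n)%N -> x <= y + c * n%:R^-1) -> x <= y.
Proof.
move=> c0 h; apply/ler_addgt0Pr => e e0.
pose n := (Num.truncn (c / e)).+1.
apply: (le_trans (h n isT)); rewrite lerD2l ler_pdivrMr ?ltr0n// mulrC.
by rewrite -ler_pdivrMr// ltW// truncnS_gt.
Qed.

Lemma sum_shift (u : nat -> R) n :
  \sum_(j < n) u j + u n = u 0 + \sum_(j < n) u j.+1.
Proof.
by transitivity (\sum_(j < n.+1) u j); [rewrite big_ord_recr|rewrite big_ord_recl].
Qed.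

(** Riemann sum on [- K, K] with 2 K n cells of length 1/n, at right endpoints, where a
    nonincreasing [F] is least. Several Choquet integral facts below are proved on such finite sums,
    up to O(1/n). *)
Definition survival_lower_sum F (K n : nat) : R :=
  n%:R^-1 * \sum_(j < (2 * K) * n) F (- K%:R + j.+1%:R * n%:R^-1) - K%:R.

Definition survival_upper_sum F (K n : nat) : R :=
  n%:R^-1 * \sum_(j < (2 * K) * n) F (- K%:R + j%:R * n%:R^-1) - K%:R.

Section Riemann.
Variables (K n : nat).
Hypothesis n0 : (0 < n)%N.

Let mesh : ((2 * K) * n)%:R * n%:R^-1 = 2 * K%:R :> R.
Proof. by rewrite !natrM mulfK// pnatr_eq0 -lt0n. Qed.

Let invn_ge0 : 0 <= n%:R^-1 :> R. Proof. by rewrite invr_ge0. Qed.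

Lemma survival_integral_sum F : survival (- K%:R) K%:R F ->
  survival_lower_sum F K n <= survival_integral F <= survival_upper_sum F K n.
Proof.
move=> sF; rewrite (survival_integralE _ sF)//; have [dF _ _] := sF.
have := Rintegral_riemann (- K%:R) ((2 * K) * n) dF invn_ge0.
have -> : - K%:R + ((2 * K) * n)%:R * n%:R^-1 = K%:R :> R by rewrite mesh; ring.
by rewrite /survival_lower_sum /survival_upper_sum !lerD2r.
Qed.

(** The difference telescopes to (F (- K) - F K) / n, and [F] takes values in [0, 1]. *)
Lemma survival_upper_sum_le F : survival (- K%:R) K%:R F ->
  survival_upper_sum F K n <= survival_lower_sum F K n + n%:R^-1.
Proof.
move=> sF; rewrite /survival_upper_sum /survival_lower_sum addrAC lerD2r.
rewrite -[X in _ + X]mulr1 -mulrDr ler_wpM2l//.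
have /andP[l0 _] := survival_range (- K%:R + (2 * K * n)%:R * n%:R^-1) sF.
have /andP[_ u1] := survival_range (- K%:R + 0 * n%:R^-1) sF.
have := sum_shift (fun j => F (- K%:R + j%:R * n%:R^-1)) (2 * K * n).
move: l0 u1 => /=; lra.
Qed.

(** Reversing the order of the cells replaces t by - t and exchanges left and right endpoints. *)
Lemma reflect_sum G :
  \sum_(j < (2 * K) * n) G (K%:R - j.+1%:R * n%:R^-1) =
  \sum_(j < (2 * K) * n) G (- K%:R + j%:R * n%:R^-1) /\
  \sum_(j < (2 * K) * n) G (K%:R - j%:R * n%:R^-1) =
  \sum_(j < (2 * K) * n) G (- K%:R + j.+1%:R * n%:R^-1).
Proof.
split; rewrite [LHS](reindex_inj rev_ord_inj)/=; apply: eq_bigr => j _; congr G.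
  rewrite -subSn ?ltn_ord// subSS natrB ?(ltnW (ltn_ord j))//.
  by rewrite mulrBl mesh; ring.
by rewrite natrB ?ltn_ord// mulrBl mesh; ring.
Qed.

End Riemann.

Lemma le_survival_integral a b F G : survival a b F -> survival a b G ->
  (forall t, F t <= G t) -> survival_integral F <= survival_integral G.
Proof.
move=> sF sG FG.
pose K := (Num.truncn (`|a| + `|b|)).+1.
have [sFK sGK] : survival (- K%:R) K%:R F /\ survival (- K%:R) K%:R G.
  have h := ltW (truncnS_gt (`|a| + `|b|)).
  have aK : - K%:R <= a.
    rewrite lerNl (le_trans _ h)// (le_trans (ler_norm (- a)))// normrN.
    by rewrite lerDl.
  have bK : b <= K%:R by rewrite (le_trans _ h)// (le_trans (ler_norm b))// lerDr.
  by split; [exact: survival_weaken sF|exact: survival_weaken sG].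
apply: (@ler_add_invn _ _ 1) => // n n0; rewrite mul1r.
have /andP[_ uF] := survival_integral_sum n0 sFK.
have /andP[lG _] := survival_integral_sum n0 sGK.
have := survival_upper_sum_le n sFK.
have : survival_lower_sum F K n <= survival_lower_sum G K n.
  by rewrite lerD2r ler_wpM2l ?invr_ge0//; apply: ler_sum.
lra.
Qed.

(** The hypotheses let [F t] differ from [1 - G (- t)] at jumps of [G], as happens between the level
    sets {f < t} and {f <= t}. In one direction the sums are shifted by a cell to absorb this. *)
Lemma survival_integral_reflect (K : nat) F G :
  survival (- K%:R) K%:R F -> survival (- K%:R) K%:R G ->
  (forall t, 1 - G (- t) <= F t) -> (forall t s, - t < s -> F t <= 1 - G s) ->
  survival_integral F = - survival_integral G.
Proof.
move=> sF sG FG GF.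
have sum1 n (u : nat -> R) : (0 < n)%N ->
    n%:R^-1 * \sum_(j < (2 * K) * n) (1 - u j) - K%:R =
    - (n%:R^-1 * \sum_(j < (2 * K) * n) u j - K%:R).
  move=> n0; rewrite sumrB sumr_const card_ord mulrBr natrM mulrCA mulVf.
    by rewrite natrM; ring.
  by rewrite pnatr_eq0 -lt0n.
apply/eqP; rewrite eq_le; apply/andP; split.
  apply: (@ler_add_invn _ _ 2) => // n n0.
  have /andP[_ uF] := survival_integral_sum n0 sF.
  have /andP[_ uG] := survival_integral_sum n0 sG.
  have uF' := survival_upper_sum_le n sF.
  have uG' := survival_upper_sum_le n sG.
  suff : survival_lower_sum F K n <= - survival_lower_sum G K n by lra.
  rewrite {2}/survival_lower_sum -(reflect_sum K n0 G).2.
  rewrite -(sum1 _ (fun j => G (K%:R - j%:R * n%:R^-1)))// lerD2r.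
  rewrite ler_wpM2l ?invr_ge0//; apply: ler_sum => j _; apply: GF.
  by rewrite opprD opprK ltrD2l ltrN2 ltr_pM2r ?invr_gt0 ?ltr0n// ltr_nat.
apply: (@ler_add_invn _ _ 1) => // n n0; rewrite mul1r.
have /andP[lF _] := survival_integral_sum n0 sF.
have /andP[lG _] := survival_integral_sum n0 sG.
have uG' := survival_upper_sum_le n sG.
suff : - survival_upper_sum G K n <= survival_lower_sum F K n by lra.
rewrite /survival_upper_sum -(reflect_sum K n0 G).1.
rewrite -(sum1 _ (fun j => G (K%:R - j.+1%:R * n%:R^-1)))// lerD2r.
rewrite ler_wpM2l ?invr_ge0//; apply: ler_sum => j _.
by have := FG (- K%:R + j.+1%:R * n%:R^-1); rewrite opprD opprK.
Qed.

(** On [- K, b] bound [F] by 1; beyond [b] it is 0. This gives (b + K) - K. *)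
Lemma survival_integral_le a b F : a <= b -> survival a b F ->
  survival_integral F <= b.
Proof.
move=> ab sF; pose K := `|a| + `|b|; have K0 : 0 <= K by rewrite addr_ge0.
have bK : b <= K by rewrite (le_trans (ler_norm b))// lerDr.
have aK : - K <= a.
  by rewrite lerNl (le_trans (ler_norm (- a)))// normrN lerDl.
have sFK := survival_weaken aK bK sF; have [dF F1 F0] := sF.
rewrite (survival_integralE K0 sFK) lerBlDr.
rewrite (Rintegral_itv_split dF (le_trans aK ab) bK).
have -> : \int[mu]_(t in `[b, K]) F t = 0.
  rewrite -Rintegral_itv_obnd_cbnd; last first.
    apply: integrableS (nonincreasing_integrable b K dF) => //.
    by apply: subset_itvr; rewrite bnd_simp.
  rewrite -[RHS](mul0r (fine (mu `]b, K]))) -Rintegral_cst//.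
  by apply: eq_Rintegral => x; rewrite inE/= in_itv/= => /andP[/F0].
rewrite addr0 -[X in _ <= X]mul1r -[X in _ + X]opprK.
rewrite -Rintegral_itv_cst ?(le_trans aK)//.
apply: le_Rintegral => //; [exact: nonincreasing_integrable..|].
by move=> x _; have /andP[] := survival_range x sF.
Qed.

End SurvivalIntegral.

(** * The Choquet integral *)

Section Capacity.
Context {R : realType} {d} {T : measurableType d}.
Implicit Types (nu : set T -> R) (f g : T -> R) (A B : set T).

Definition capacity nu := [/\ nu set0 = 0, nu setT = 1 &
  forall A B, measurable A -> measurable B -> A `<=` B -> nu A <= nu B].

Lemma capacity_conjugate nu : capacity nu -> capacity (conjugate nu).
Proof.
move=> [nu0 nu1 numono]; split; rewrite /conjugate ?setC0 ?setCT ?nu0 ?nu1.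
- exact: subrr.
- exact: subr0.
- move=> A B mA mB AB; rewrite lerD2l lerN2.
  by apply: numono; [exact: measurableC..|exact: subsetC].
Qed.

Lemma measurable_level f t : measurable_fun [set: T] f ->
  measurable [set w | t <= f w].
Proof.
by move=> mf; rewrite -[X in measurable X]setTI; apply: measurable_fun_ler.
Qed.

Section Choquet.
Variable nu : set T -> R.
Hypothesis cnu : capacity nu.

Let nu0 : nu set0 = 0. Proof. by have [] := cnu. Qed.
Let nu1 : nu setT = 1. Proof. by have [] := cnu. Qed.
Let numono A B : measurable A -> measurable B -> A `<=` B -> nu A <= nu B.
Proof. by have [_ _] := cnu; exact. Qed.
Let nu_ge0 A : measurable A -> 0 <= nu A.
Proof. by move=> mA; rewrite -nu0; exact: numono. Qed.

Definition level_function (f : T -> R) (t : R) : R := nu [set w | t <= f w].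

Lemma choquetE f : choquet nu f = survival_integral (level_function f).
Proof. by rewrite /choquet nu1. Qed.

Lemma survival_level_function a b f : measurable_fun [set: T] f ->
  (forall w, a <= f w <= b) -> survival a b (level_function f).
Proof.
move=> mf fab; split.
- move=> s t st; apply: numono; [exact: measurable_level..|].
  by move=> w /=; exact: le_trans st.
- move=> s sa; rewrite -[RHS]nu1; congr nu; apply/seteqP; split => // w _ /=.
  by have /andP[+ _] := fab w; apply: le_trans; exact: ltW.
- move=> s bs; rewrite -[RHS]nu0; congr nu; apply/seteqP; split => // w /= sf.
  by have /andP[_] := fab w; rewrite leNgt (lt_le_trans bs sf).
Qed.

Lemma bounded_mfun_nat f : bounded_mfun f ->
  exists K : nat, forall w, - K%:R <= f w <= K%:R.
Proof.
move=> [_ [K fK]]; exists (Num.truncn K).+1 => w.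
by rewrite -ler_norml (le_trans (fK w))// ltW// truncnS_gt.
Qed.

Lemma le_choquet f g : bounded_mfun f -> bounded_mfun g ->
  (forall w, f w <= g w) -> choquet nu f <= choquet nu g.
Proof.
move=> bf bg fg; have [K fK] := bounded_mfun_nat bf.
have [L gL] := bounded_mfun_nat bg; have [[mf _] [mg _]] := (bf, bg).
have fgw w : - (K%:R + L%:R) <= f w <= K%:R + L%:R /\
             - (K%:R + L%:R) <= g w <= K%:R + L%:R.
  move: (fK w) (gL w) (ler0n R K) (ler0n R L) => /andP[? ?] /andP[? ?] ? ?.
  by split; apply/andP; split; lra.
rewrite !choquetE; apply: (@le_survival_integral _ (- (K%:R + L%:R)) (K%:R + L%:R)).
- by apply: survival_level_function => // w; have [] := fgw w.
- by apply: survival_level_function => // w; have [] := fgw w.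
- move=> t; apply: numono; [exact: measurable_level..|].
  by move=> w /= tf; exact: le_trans tf (fg w).
Qed.

(** The bound on [f] is only required up to [nu]-null levels, as ergodicity provides it; [f] itself
    may exceed [b]. *)
Lemma choquet_le b f : bounded_mfun f ->
  (forall t, b < t -> nu [set w | t <= f w] = 0) -> choquet nu f <= b.
Proof.
move=> bf f0; have [K fK] := bounded_mfun_nat bf; have [mf _] := bf.
have [dF F1 _] := survival_level_function mf fK.
have bK : - K%:R <= b.
  rewrite leNgt; apply/negP => bK; have [bm mK] := midf_lt bK.
  by move/eqP: (f0 _ bm); rewrite -/(level_function _ _) F1// oner_eq0.
by rewrite choquetE; apply: survival_integral_le bK _; split.
Qed.

(** For an integer factor the grids match: the sum of [n * f] on [- n K, n K] with mesh 1/m is n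
    times the sum of [f] on [- K, K] with mesh 1/(m n), level set by level set. *)
Lemma choquet_scale n f : (0 < n)%N -> bounded_mfun f ->
  choquet nu (fun w => n%:R * f w) = n%:R * choquet nu f.
Proof.
move=> n0 bf; have [K fK] := bounded_mfun_nat bf; have [mf _] := bf.
have [mnf _] := bounded_mfunZ n%:R bf.
have nfK w : - (n * K)%:R <= n%:R * f w <= (n * K)%:R.
  by rewrite natrM -mulrN !ler_wpM2l//; have /andP[] := fK w.
have sf := survival_level_function mf fK.
have snf := survival_level_function mnf nfK.
rewrite !choquetE.
have n0' : n%:R != 0 :> R by rewrite pnatr_eq0 -lt0n.
have E m : (0 < m)%N -> survival_lower_sum (level_function (fun w => n%:R * f w))
    (n * K) m = n%:R * survival_lower_sum (level_function f) K (m * n).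
  move=> m0; have m0' : m%:R != 0 :> R by rewrite pnatr_eq0 -lt0n.
  have -> : n%:R * survival_lower_sum (level_function f) K (m * n) =
      m%:R^-1 * \sum_(j < 2 * K * (m * n))
        level_function f (- K%:R + j.+1%:R * (m * n)%:R^-1) - (n * K)%:R.
    rewrite /survival_lower_sum !natrM; set s := \sum_(j < _) _.
    by field; rewrite m0' n0'.
  rewrite /survival_lower_sum.
  have -> : (2 * (n * K) * m = 2 * K * (m * n))%N by ring.
  congr (_ * _ - _); apply: eq_bigr => j _; congr nu.
  apply/funext => w /=; rewrite -[in RHS](ler_pM2l (_ : 0 < n%:R :> R)) ?ltr0n//.
  suff -> : n%:R * (- K%:R + j.+1%:R / (m * n)%:R) =
            - (n * K)%:R + j.+1%:R / m%:R :> R by [].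
  by rewrite !natrM; field; rewrite m0' n0'.
apply/eqP; rewrite eq_le; apply/andP; split.
  apply: (@ler_add_invn _ _ _ 1) => // m m0; rewrite mul1r.
  have /andP[_ u] := survival_integral_sum m0 snf.
  have := survival_upper_sum_le m snf; rewrite E//.
  have mn0 : (0 < m * n)%N by rewrite muln_gt0 m0.
  have /andP[l _] := survival_integral_sum mn0 sf.
  have : n%:R * survival_lower_sum (level_function f) K (m * n) <=
    n%:R * survival_integral (level_function f) by rewrite ler_wpM2l.
  by move: u; lra.
apply: (@ler_add_invn _ _ _ 1) => // m m0; rewrite mul1r.
have /andP[l _] := survival_integral_sum m0 snf; rewrite E// in l.
have mn0 : (0 < m * n)%N by rewrite muln_gt0 m0.
have /andP[_ u] := survival_integral_sum mn0 sf.
have u' := survival_upper_sum_le (m * n) sf.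
have : n%:R * survival_integral (level_function f) <=
    n%:R * (survival_lower_sum (level_function f) K (m * n) + (m * n)%:R^-1).
  by rewrite ler_wpM2l// (le_trans u).
have -> : n%:R * (survival_lower_sum (level_function f) K (m * n) + (m * n)%:R^-1)
  = n%:R * survival_lower_sum (level_function f) K (m * n) + m%:R^-1.
  rewrite mulrDr natrM; congr (_ + _).
  by rewrite invfM mulrCA divff ?mulr1.
by move: l; lra.
Qed.

(** * Superadditivity of the Choquet integral through integer-valued functions *)

Section Layers.
Implicit Types (u v : T -> nat).

Definition nat_mlevels u := forall j, measurable [set w | (j < u w)%N].

(** For [u <= N] this is the Choquet integral of [u]. *)
Definition layer_sum N u : R := \sum_(j < N) nu [set w | (j < u w)%N].

Lemma nat_mlevels_le u j : nat_mlevels u -> measurable [set w | (j <= u w)%N].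
Proof.
by case: j => [|j] mu; [rewrite (_ : mkset _ = setT)//; apply/seteqP; split|exact: mu].
Qed.

Let step_levels u A j : [set w | (j < u w + (w \in A))%N] =
  [set w | (j < u w)%N] `|` ([set w | (j <= u w)%N] `&` A).
Proof.
apply/seteqP; split=> w /=.
  case: (boolP (w \in A)) => [/set_mem Aw|_]; last by rewrite addn0; left.
  by rewrite addn1 ltnS => ?; right.
by case=> [ju|[ju /mem_set ->]]; rewrite ?addn1// ltn_addr.
Qed.

Lemma nat_mlevels_step u A : nat_mlevels u -> measurable A ->
  nat_mlevels (fun w => u w + (w \in A))%N.
Proof.
move=> mu mA j; rewrite step_levels; apply: measurableU => //.
by apply: measurableI => //; exact: nat_mlevels_le.
Qed.

Hypothesis convex_nu : convex_set_function nu.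

(* With F_j = {j <= u}, {j < u + 1_A} is the union of F_(j+1) and F_j :&: A, whose
   intersection is F_(j+1) :&: A: summing convexity over j telescopes. *)
Lemma layer_sum_step N u A : nat_mlevels u -> measurable A ->
  (forall w, (u w + (w \in A) <= N)%N) ->
  layer_sum N u + nu A <= layer_sum N (fun w => u w + (w \in A))%N.
Proof.
move=> mu mA uN.
pose c j := nu ([set w | (j <= u w)%N] `&` A).
have mc j : measurable ([set w | (j <= u w)%N] `&` A).
  by apply: measurableI => //; exact: nat_mlevels_le.
have c0 : c 0 = nu A by congr nu; apply/seteqP; split=> w //= [].
(* Since u + 1_A <= N, no point of [A] has [u >= N]; this closes the telescoping sum. *)
have cN : c N = 0.
  rewrite -[RHS]nu0; congr nu; apply/seteqP; split=> w //= -[Nu Aw].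
  by have := uN w; rewrite mem_set// addn1 leqNgt ltnS Nu.
have le_j (j : nat) : nu [set w | (j < u w)%N] + c j <=
    nu [set w | (j < u w + (w \in A))%N] + c j.+1.
  apply: (le_trans (convex_nu (mu j) (mc j))); rewrite -step_levels lerD2l.
  rewrite le_eqVlt; apply/orP; left; apply/eqP; congr nu.
  apply/seteqP; split=> w /=; first by move=> [? []].
  by move=> [ju Aw]; split=> //; split=> //; exact: ltnW.
have := sum_shift c N; rewrite cN addr0 c0 /layer_sum => cE.
have : \sum_(j < N) (nu [set w | (j < u w)%N] + c j) <=
  \sum_(j < N) (nu [set w | (j < u w + (w \in A))%N] + c j.+1) by exact: ler_sum.
by rewrite !big_split/= cE; lra.
Qed.

(** Raising the truncation of [v] by one adds the indicator of a single level set, so [v] is added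
    to [u] layer by layer with [layer_sum_step]. *)
Let add_minnS u v M : (fun w => u w + minn (v w) M.+1)%N =
  (fun w => (u w + minn (v w) M) + (w \in [set w | (M < v w)%N]))%N.
Proof.
apply/funext => w; rewrite -addnA; congr addn.
have -> : (w \in [set w | (M < v w)%N]) = (M < v w)%N by apply/idP/idP; rewrite inE.
case: (ltnP M (v w)) => h; last by rewrite addn0 !(minn_idPl _)// ltnW.
by rewrite !(minn_idPr _) ?addn1// ltnW.
Qed.

Let add_minn0 u v : (fun w => u w + minn (v w) 0)%N = u.
Proof. by apply/funext => w; rewrite minn0 addn0. Qed.

Let nat_mlevels_add_minn u v M : nat_mlevels u -> nat_mlevels v ->
  nat_mlevels (fun w => u w + minn (v w) M)%N.
Proof.
move=> mu mv; elim: M => [|M IHM]; first by rewrite add_minn0.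
by rewrite add_minnS; exact: nat_mlevels_step.
Qed.

(** Whether u + v exceeds j depends on [v] only through its truncation at j + 1. *)
Lemma nat_mlevels_add u v : nat_mlevels u -> nat_mlevels v ->
  nat_mlevels (fun w => u w + v w)%N.
Proof.
move=> mu mv j; have := nat_mlevels_add_minn j.+1 mu mv j.
congr measurable; apply/funext => w /=; rewrite /minn; case: (ltnP (v w) j.+1) => // jv.
by rewrite (ltn_addl _ jv) (ltn_addl _ (ltnSn j)).
Qed.

Lemma layer_sum_superadd N u v : nat_mlevels u -> nat_mlevels v ->
  (forall w, (u w + v w <= N)%N) ->
  layer_sum N u + layer_sum N v <= layer_sum N (fun w => u w + v w)%N.
Proof.
move=> mu mv uvN.
suff h M : layer_sum N u + \sum_(j < M) nu [set w | (j < v w)%N] <=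
    layer_sum N (fun w => u w + minn (v w) M)%N.
  have := h N; rewrite (_ : (fun w => _) = (fun w => u w + v w)%N)//.
  by apply/funext => w; rewrite (minn_idPl _)// (leq_trans _ (uvN w))// leq_addl.
elim: M => [|M IHM]; first by rewrite add_minn0 big_ord0 addr0.
rewrite add_minnS big_ord_recr/= addrA.
apply: le_trans (layer_sum_step (nat_mlevels_add_minn M mu mv) (mv M) _).
  by rewrite lerD2r.
move=> w; have := congr1 (fun F => F w) (add_minnS u v M) => /= <-.
by rewrite (leq_trans _ (uvN w))// leq_add2l geq_minl.
Qed.

(** Counts the right endpoints of the grid of mesh 1/n from - K that lie at or below [f w]; its
    layer sum is thus the lower Riemann sum up to scaling. *)
Let step_count (K n : nat) f w : nat := Num.truncn (n%:R * (f w + K%:R)).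

Let step_count_levels K n f j : (0 < n)%N ->
  [set w | (j < step_count K n f w)%N] = [set w | - K%:R + j.+1%:R * n%:R^-1 <= f w].
Proof.
move=> n0; apply/funext => w /=; rewrite /step_count truncn_gt_nat.
by rewrite [- K%:R + _]addrC lerBlDr ler_pdivrMr ?ltr0n// mulrC.
Qed.

Let nat_mlevels_step_count K n f : (0 < n)%N -> measurable_fun [set: T] f ->
  nat_mlevels (step_count K n f).
Proof. by move=> n0 mf j; rewrite step_count_levels//; exact: measurable_level. Qed.

Let lower_sum_step_count K n f : (0 < n)%N ->
  survival_lower_sum (level_function f) K n =
  n%:R^-1 * layer_sum (2 * K * n) (step_count K n f) - K%:R.
Proof.
move=> n0; congr (_ * _ - _); apply: eq_bigr => j _; congr nu.
by rewrite step_count_levels.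
Qed.

Lemma layer_sum_widen N M u : nat_mlevels u -> layer_sum N u <= layer_sum (N + M) u.
Proof.
move=> mu; rewrite /layer_sum big_split_ord/= lerDl; apply: sumr_ge0 => j _.
exact: nu_ge0.
Qed.

(** Discretize [f] and [g] to integer-valued functions, for which convexity gives superadditivity.
    Since floor x + floor y <= floor (x + y), the result is below the discretization of f + g; the
    Riemann errors total 2/n. *)
Lemma choquet_superadd f g : bounded_mfun f -> bounded_mfun g ->
  choquet nu f + choquet nu g <= choquet nu (fun w => f w + g w).
Proof.
move=> bf bg; have [K1 fK1] := bounded_mfun_nat bf.
have [K2 gK2] := bounded_mfun_nat bg; have [[mf _] [mg _]] := (bf, bg).
pose K := (K1 + K2)%N.
have fK w : - K%:R <= f w <= K%:R.
  rewrite natrD; move: (fK1 w) (ler0n R K2) => /andP[? ?] ?.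
  by apply/andP; split; lra.
have gK w : - K%:R <= g w <= K%:R.
  rewrite natrD; move: (gK2 w) (ler0n R K1) => /andP[? ?] ?.
  by apply/andP; split; lra.
have fgK w : - (K + K)%:R <= f w + g w <= (K + K)%:R.
  rewrite natrD; move: (fK w) (gK w) => /andP[? ?] /andP[? ?].
  by apply/andP; split; lra.
have [mfg _] := bounded_mfunD bf bg.
have sf := survival_level_function mf fK.
have sg := survival_level_function mg gK.
have sfg := survival_level_function mfg fgK.
rewrite !choquetE; apply: (@ler_add_invn _ _ _ 2) => // n n0.
have /andP[_ uf] := survival_integral_sum n0 sf.
have /andP[_ ug] := survival_integral_sum n0 sg.
have /andP[lfg _] := survival_integral_sum n0 sfg.
have uf' := survival_upper_sum_le n sf.
have ug' := survival_upper_sum_le n sg.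
suff : survival_lower_sum (level_function f) K n +
       survival_lower_sum (level_function g) K n <=
       survival_lower_sum (level_function (fun w => f w + g w)) (K + K) n.
  by move: lfg; lra.
rewrite !lower_sum_step_count//.
set u := step_count K n f; set v := step_count K n g; set uv := step_count _ _ _.
have mu : nat_mlevels u by exact: nat_mlevels_step_count.
have mv : nat_mlevels v by exact: nat_mlevels_step_count.
have muv : nat_mlevels uv by exact: nat_mlevels_step_count.
have ge0 (h : T -> R) w : (forall w, - K%:R <= h w <= K%:R) ->
    0 <= n%:R * (h w + K%:R).
  by move=> hK; rewrite mulr_ge0// -lerBlDr sub0r; have /andP[] := hK w.
have sum_le w : (u w + v w <= uv w)%N.
  rewrite /uv /step_count truncn_ge_nat; last first.
    by rewrite mulr_ge0// -lerBlDr sub0r; have /andP[] := fgK w.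
  rewrite natrD (@le_trans _ _ (n%:R * (f w + K%:R) + n%:R * (g w + K%:R)))//.
    by apply: lerD; rewrite truncn_le ge0.
  by rewrite natrD -mulrDr; apply: ler_wpM2l => //; lra.
have uv_le w : (uv w <= 2 * (K + K) * n)%N.
  rewrite /uv /step_count -ltnS truncn_lt_nat; last first.
    by rewrite mulr_ge0// -lerBlDr sub0r; have /andP[] := fgK w.
  rewrite -natr1 (@le_lt_trans _ _ (2 * (K + K) * n)%:R) ?ltrDl//.
  rewrite natrM mulrC ler_wpM2r// natrM; have /andP[_] := fgK w; lra.
have : layer_sum (2 * K * n) u + layer_sum (2 * K * n) v <=
    layer_sum (2 * (K + K) * n) uv.
  have -> : (2 * (K + K) * n = 2 * K * n + 2 * K * n)%N by ring.
  apply: (@le_trans _ _ (layer_sum (2 * K * n + 2 * K * n) (fun w => u w + v w)%N)).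
    apply: le_trans (layer_sum_superadd mu mv _).
      by apply: lerD; exact: layer_sum_widen.
    move=> w; rewrite (leq_trans (sum_le w))// (leq_trans (uv_le w))//.
    by rewrite mulnDr mulnDl.
  apply: ler_sum => j _; apply: numono => //; last first.
    by move=> w /= h; exact: leq_trans (sum_le w).
  exact: (nat_mlevels_add mu mv).
move=> hs; have : n%:R^-1 * (layer_sum (2 * K * n) u + layer_sum (2 * K * n) v) <=
    n%:R^-1 * layer_sum (2 * (K + K) * n) uv by rewrite ler_wpM2l// invr_ge0.
by rewrite natrD; lra.
Qed.

End Layers.

End Choquet.

(** The complement of {f >= t} is {f < t}, while - f has the level set {f <= t};
    [survival_integral_reflect] tolerates the difference. *)
Lemma choquet_conjugate nu f : capacity nu -> bounded_mfun f ->
  choquet (conjugate nu) f = - choquet nu (fun w => - f w).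
Proof.
move=> cnu bf; have [_ _ numono] := cnu; have [K fK] := bounded_mfun_nat bf; have [mf _] := bf.
have [mnf _] := bounded_mfunN bf.
have nfK w : - K%:R <= - f w <= K%:R.
  by have /andP[? ?] := fK w; rewrite lerN2 lerNl; apply/andP.
have ccnu := capacity_conjugate cnu.
have setE t : ~` [set w | t <= f w] = [set w | f w < t].
  by apply/seteqP; split=> w /=; rewrite ltNge => /negP.
have mlt t : measurable [set w | f w < t].
  by rewrite -setE; apply: measurableC; exact: measurable_level.
rewrite !choquetE//.
apply: (@survival_integral_reflect _ K).
- exact: survival_level_function.
- exact: survival_level_function.
- move=> t; rewrite /level_function /conjugate setE lerD2l lerN2; apply: numono => //.
    exact: measurable_level.
  by move=> w /= /ltW; rewrite lerN2.
- move=> t s ts; rewrite /level_function /conjugate setE lerD2l lerN2; apply: numono => //.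
    exact: measurable_level.
  by move=> w /= sf; rewrite -ltrN2 (lt_le_trans ts).
Qed.

End Capacity.

(** * Lower bounds and perturbation of Choquet integrals *)

Section ChoquetBounds.
Context {R : realType} {d} {T : measurableType d}.
Implicit Types (nu : set T -> R) (f g : T -> R) (A B : set T).

Lemma conjugateK nu : conjugate (conjugate nu) = nu.
Proof. by apply/funext => A; rewrite /conjugate setCK opprB addrC subrK. Qed.

Lemma capacity_le1 nu A : capacity nu -> measurable A -> nu A <= 1.
Proof. by move=> [_ <- mono] mA; exact: mono. Qed.

(** Dual to [choquet_le], applied to the conjugate and - f. *)
Lemma choquet_ge nu a f : capacity nu -> bounded_mfun f ->
  (forall t, t < a -> nu [set w | t <= f w] = 1) -> a <= choquet nu f.
Proof.
move=> cnu bf f1; have ccnu := capacity_conjugate cnu.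
rewrite -[nu]conjugateK (choquet_conjugate ccnu bf) lerNr.
apply: (choquet_le ccnu (bounded_mfunN bf)) => t ta.
have mle s : measurable [set w | s <= f w] by apply: measurable_level; case: bf.
have mNle s : measurable [set w | s <= - f w].
  by apply: measurable_level; case: (bounded_mfunN bf).
(* A level strictly between - t and a: {f >= s} has capacity 1 and is contained in {f > - t}. *)
have [ts sa] : - t < (a - t) / 2 /\ (a - t) / 2 < a by split; lra.
have [_ _ mono] := cnu.
apply/eqP; rewrite subr_eq0 eq_le capacity_le1 ?andbT//; last exact: measurableC.
rewrite -(f1 _ sa); apply: mono => //; first exact: measurableC.
by move=> w /= h1; apply/negP; rewrite -ltNge; lra.
Qed.

(** Read off the Riemann sum with [K = n = 1]: the nodes 0 and 1 contribute 1 and [nu A]. *)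
Lemma choquet_indic_ge nu A : capacity nu -> measurable A ->
  nu A <= choquet nu \1_A.
Proof.
move=> cnu mA; have [_ nu1 _] := cnu.
have sA : survival (- 1%:R) 1%:R (level_function nu (\1_A : T -> R)).
  apply: survival_level_function => //.
  by move=> w; rewrite indicE; case: (_ \in _) => /=; apply/andP; split; lra.
rewrite choquetE//; have /andP[+ _] := survival_integral_sum (ltn0Sn 0) sA.
apply: le_trans; rewrite /survival_lower_sum invr1 mul1r.
rewrite big_ord_recl big_ord1 /= !mulr1 addNr.
have -> : level_function nu (\1_A : T -> R) 0 = 1.
  by rewrite -nu1; congr nu; apply/seteqP; split => // w _ /=; rewrite indicE.
have -> : - 1 + 2 = 1 :> R by lra.
have -> : level_function nu (\1_A : T -> R) 1 = nu A.
  congr nu; apply/seteqP; split => w /=; rewrite indicE.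
    by case: (boolP (w \in A)) => [/set_mem//|_]; rewrite ler10.
  by move=> /mem_set ->.
by lra.
Qed.

Lemma choquet_comp nu (tau : T -> T) f : capacity nu ->
  (forall A, measurable A -> nu (tau @^-1` A) = nu A) ->
  measurable_fun [set: T] f -> choquet nu (fun w => f (tau w)) = choquet nu f.
Proof.
move=> cnu inv mf; rewrite !choquetE//; congr survival_integral.
by apply/funext => t; rewrite /level_function -[RHS]inv//; exact: measurable_level.
Qed.

(* Off a set of nu-measure close to 1 the error is paid by the integral of
   [- e - 2 K \1_(~` A)], which is at least [- e - 2 K (1 - nu A)]. *)
Lemma choquet_perturb nu (K : nat) e A f g : capacity nu ->
  convex_set_function nu -> measurable A -> bounded_mfun f -> bounded_mfun g ->
  (0 < K)%N ->
  (forall w, `|f w| <= K%:R) -> (forall w, `|g w| <= K%:R) -> 0 <= e ->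
  (forall w, A w -> f w - e <= g w) ->
  choquet nu f - e - (2 * K)%:R * (1 - nu A) <= choquet nu g.
Proof.
move=> cnu vnu mA bf bg K0 fK gK e0 fg.
have bA : bounded_mfun (\1_A : T -> R) by exact: bounded_mfun_indic.
have bc (c : R) : bounded_mfun (fun _ : T => c) by exact: bounded_mfun_cst.
have cst_ge (c : R) : c <= choquet nu (fun=> c).
  apply: choquet_ge => // t tc; have [_ <- _] := cnu; congr nu.
  by apply/seteqP; split=> // w _; exact: ltW.
have b1 := bounded_mfunD bA (bc (-1)).
have b2 := bounded_mfunZ (2 * K)%:R b1.
have b3 := bounded_mfunD b2 (bc (- e)).
(* Off [A] the subtracted 2 K brings [f] below - K, hence below [g]. *)
apply: (@le_trans _ _ (choquet nu (fun w =>
    f w + ((2 * K)%:R * ((\1_A w : R) + -1) + - e)))); last first.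
  apply: le_choquet => //; first exact: bounded_mfunD.
  move=> w; rewrite indicE; case: (boolP (w \in A)) => [/set_mem/fg|_] /=.
    by rewrite subrr mulr0; lra.
  have := fK w; have := gK w; rewrite !ler_norml natrM => /andP[? ?] /andP[? ?].
  by lra.
apply: le_trans (choquet_superadd cnu vnu bf b3).
have := choquet_superadd cnu vnu b2 (bc (- e)).
have := cst_ge (- e); have := choquet_superadd cnu vnu bA (bc (-1)).
have := cst_ge (-1); have := choquet_indic_ge cnu mA.
have K20 : (0 < 2 * K)%N by rewrite muln_gt0.
rewrite (choquet_scale cnu K20 b1) => h1 h2 h3 h4 h5.
have : (2 * K)%:R * (nu A - 1) <=
    (2 * K)%:R * choquet nu (fun w => (\1_A w : R) + -1).
  by apply: ler_wpM2l => //; lra.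
by lra.
Qed.

End ChoquetBounds.

(** * Lower envelopes *)

Section LowerEnvelope.
Context {R : realType} {d} {T : measurableType d}.
Variables (nu : set T -> R) (M : set (probability T R)).
Hypothesis envM : is_lower_envelope M nu.
Hypothesis compactM : compact (M : set (setwise_probability R T)).

Lemma probability1_ae (P : probability T R) A : measurable A ->
  P A = 1%E <-> {ae P, forall w, A w}.
Proof.
move=> mA; have PC : P (~` A) = (1 - P A)%E by exact: probability_setC.
split=> [PA|[N [mN PN sN]]].
  exists (~` A); split => //; first exact: measurableC.
  by apply: eq_trans PC _; rewrite PA subee.
have PC0 : P (~` A) = 0%E.
  apply/eqP; rewrite eq_le measure_ge0 andbT -PN; apply: le_measure => //.
    by rewrite inE; exact: measurableC.
  by rewrite inE.
have := probability_setC P (measurableC mA); rewrite setCK => ->.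
by rewrite [X in (_ - X)%E]PC0 sube0.
Qed.

Lemma capacity_lower_envelope : capacity nu.
Proof.
split.
- by have [[P _ +] _] := envM measurable0; rewrite measure0 => -[].
- by have [[P _ +] _] := envM measurableT; rewrite probability_setT => -[].
- move=> A B mA mB AB; have [[P MP PB] _] := envM mB.
  have [_ /(_ P MP) nuA] := envM mA.
  rewrite -lee_fin -PB (le_trans nuA)//.
  by apply: le_measure; rewrite ?inE.
Qed.

(** Reduces statements holding [nu]-a.s. to each [P] in [M] separately; the converse uses that the
    minimum is attained. *)
Lemma lower_envelope1P A : measurable A ->
  nu A = 1 <-> forall P, M P -> {ae P, forall w, A w}.
Proof.
move=> mA; split=> [nuA P MP|h].
  apply/(probability1_ae P mA)/eqP; rewrite eq_le probability_le1//=.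
  by have [_ /(_ P MP)] := envM mA; rewrite nuA.
have [[P MP PA] _] := envM mA.
by have /(probability1_ae P mA) := h P MP; rewrite PA => -[].
Qed.

Lemma lower_envelope_invariant (tau : T -> T) : measurable_fun [set: T] tau ->
  M `<=` invariant_probabilities tau ->
  forall A, measurable A -> nu (tau @^-1` A) = nu A.
Proof.
move=> mtau MI A mA.
have mtA : measurable (tau @^-1` A) by rewrite -[X in measurable X]setTI; exact: mtau.
apply/eqP; rewrite eq_le -!lee_fin; apply/andP; split.
  have [[P MP <-] _] := envM mA; rewrite (MI P MP)//.
  by have [_ ] := envM mtA; apply.
have [[P MP <-] _] := envM mtA; rewrite -(MI P MP)//.
by have [_ ] := envM mA; apply.
Qed.

(* Minimizers for the sets A n cluster at some P in M, and P (A n) <= c. *)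
Lemma lower_envelope_continuous1 (A : nat -> set T) c :
  (forall n, measurable (A n)) -> nondecreasing_seq A ->
  nu (\bigcup_n A n) = 1 -> c < 1 -> exists N, c < nu (A N).
Proof.
move=> mA ndA nuA c1; apply: contrapT => hN.
have nuAc n : nu (A n) <= c by rewrite leNgt; apply/negP => h; apply: hN; exists n.
have [P_ MP_ PA_] : exists2 P_ : nat -> probability T R, forall n, M (P_ n) &
    forall n, P_ n (A n) = (nu (A n))%:E.
  have /choice[P_ hP] n : exists P, M P /\ P (A n) = (nu (A n))%:E.
    by have [[P MP PA] _] := envM (mA n); exists P.
  by exists P_ => n; have [] := hP n.
pose F : set_system (setwise_probability R T) := P_ @ \oo.
have FM : F M by exists 0 => // n _; exact: MP_.
have [P [MP clP]] := compactM (_ : ProperFilter F) FM.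
(* For m >= n the minimizers satisfy P_m (A n) <= P_m (A m) = nu (A m) <= c; a setwise cluster point
   inherits this bound. *)
have PA n : fine ((P : probability T R) (A n)) <= c.
  rewrite leNgt; apply/negP => cP.
  have /cvg_setwise/(_ (A n) (mA n)) := @cvg_id _ (nbhs P).
  move=> /(cvgr_gt _)/(_ _ cP) nearP.
  have FP : F [set Q | fine ((Q : probability T R) (A n)) <= c].
    exists n => // m /= nm; apply: le_trans (nuAc m).
    rewrite -lee_fin fineK ?fin_num_measure// -PA_ le_measure ?inE//.
    exact/subsetPset/ndA.
  have [Q [/= Q1 Q2]] := clP _ _ FP nearP.
  by move: Q2; rewrite ltNge Q1.
have mU : measurable (\bigcup_n A n) by exact: bigcupT_measurable.
have : (fine \o (P : probability T R) \o A) n @[n --> \oo] -->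
    fine ((P : probability T R) (\bigcup_n A n)).
  apply: fine_cvg; rewrite fineK ?fin_num_measure//.
  exact: nondecreasing_cvg_mu.
have PU : c < fine ((P : probability T R) (\bigcup_n A n)).
  rewrite (lt_le_trans c1)// -nuA -lee_fin fineK ?fin_num_measure//.
  by have [_ ] := envM mU; apply.
by move=> /(cvgr_gt _)/(_ _ PU)[N _ /(_ N (leqnn N))] /=; rewrite ltNge PA.
Qed.

Let cnu : capacity nu := capacity_lower_envelope.

Lemma lower_envelope1_subset A B : measurable A -> measurable B -> A `<=` B ->
  nu A = 1 -> nu B = 1.
Proof.
move=> mA mB AB nuA; apply/eqP; rewrite eq_le (capacity_le1 cnu mB) -nuA.
by have [_ _ mono] := cnu; exact: mono.
Qed.

(* Egorov's argument, with lower_envelope_continuous1 in place of the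
   continuity of a measure. *)
Lemma choquet_cvg (K : nat) (u : nat -> T -> R) (f : T -> R) : convex_set_function nu ->
  (forall n, measurable_fun [set: T] (u n)) -> measurable_fun [set: T] f ->
  (forall n w, `|u n w| <= K%:R) -> (forall w, `|f w| <= K%:R) ->
  almost_surely nu (fun w => u n w @[n --> \oo] --> f w) ->
  choquet nu (u n) @[n --> \oo] --> choquet nu f.
Proof.
move=> vnu mu mf uK fK [C [mC nuC uf]]; apply/cvgrPdist_le => e e0.
have bu n : bounded_mfun (u n) by split; [exact: mu|exists K%:R].
have bf : bounded_mfun f by split => //; exists K%:R.
pose A N := \bigcap_(m in [set m | (N <= m)%N]) [set w | `|u m w - f w| <= e / 2].
have mA N : measurable (A N).
  apply: bigcap_measurableType => m _; rewrite -[X in measurable X]setTI.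
  apply: measurable_fun_ler => //; apply: measurableT_comp => //.
  exact: measurable_funB.
have ndA : nondecreasing_seq A.
  by move=> m n mn; apply/subsetPset => w Aw k /= nk; apply: Aw; exact: leq_trans nk.
have nuA : nu (\bigcup_N A N) = 1.
  apply: (lower_envelope1_subset mC) nuC; first exact: bigcupT_measurable.
  move=> w /uf /cvgrPdist_le/(_ (e / 2)); rewrite divr_gt0// => /(_ isT)[N _ hN].
  by exists N => // m /= Nm; rewrite distrC; exact: hN.
have K20 : 0 < (2 * K.+1)%:R :> R by rewrite ltr0n.
(* Chosen so that nu (A N) > c bounds the exceptional term by e / 2. [K.+1] replaces [K] to have a
   positive bound. *)
pose c := 1 - e / 2 / (2 * K.+1)%:R.
have [|N hN] := @lower_envelope_continuous1 A c mA ndA nuA.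
  by rewrite /c ltrBlDr ltrDl !divr_gt0.
have {}hN : (2 * K.+1)%:R * (1 - nu (A N)) <= e / 2.
  by rewrite mulrC -ler_pdivlMr// lerBlDr -lerBlDl ltW.
have K1 (g : T -> R) : (forall w, `|g w| <= K%:R) -> forall w, `|g w| <= K.+1%:R.
  by move=> gK w; rewrite (le_trans (gK w))// ler_nat.
have e20 : 0 <= e / 2 by rewrite divr_ge0// ltW.
exists N => // m /= Nm; rewrite ler_norml; apply/andP; split.
  have : choquet nu (u m) - e / 2 - (2 * K.+1)%:R * (1 - nu (A N)) <= choquet nu f.
    apply: (choquet_perturb cnu vnu) => //; try exact: K1.
    by move=> w /(_ m Nm)/=; rewrite ler_norml => /andP[_]; lra.
  by lra.
have : choquet nu f - e / 2 - (2 * K.+1)%:R * (1 - nu (A N)) <= choquet nu (u m).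
  apply: (choquet_perturb cnu vnu) => //; try exact: K1.
  by move=> w /(_ m Nm)/=; rewrite ler_norml => /andP[+ _]; lra.
by lra.
Qed.

(** If some level below the integral had capacity 0, so would all higher ones, and [choquet_le]
    would make the integral smaller. *)
Lemma choquet_level1 (f : T -> R) : bounded_mfun f ->
  (forall t, nu [set w | t <= f w] = 0 \/ nu [set w | t <= f w] = 1) ->
  nu [set w | choquet nu f <= f w] = 1.
Proof.
move=> bf f01; have [mf _] := bf; set c := choquet nu f.
have f1 t : t < c -> nu [set w | t <= f w] = 1.
  move=> tc; case: (f01 t) => // ft0; have : c <= t; last by rewrite leNgt tc.
  apply: (choquet_le cnu bf) => s ts; case: (f01 s) => // fs1.
  have : nu [set w | s <= f w] <= nu [set w | t <= f w].
    have [_ _ mono] := cnu; apply: mono; [exact: measurable_level..|].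
    by move=> w /=; apply: le_trans; exact: ltW.
  by rewrite fs1 ft0 ler10.
apply/lower_envelope1P => [|P MP]; first exact: measurable_level.
(* The level at [c] itself is reached as a countable intersection of levels below [c], under each
   [P]. *)
have : {ae P, forall w, forall n : nat, c - n.+1%:R^-1 <= f w}.
  apply: ae_foralln => n.
  have /lower_envelope1P : nu [set w | c - n.+1%:R^-1 <= f w] = 1.
    by apply: f1; rewrite ltrBlDr ltrDl invr_gt0.
  by apply => //; exact: measurable_level.
apply: filterS => w fw /=; apply: (@ler_add_invn _ _ _ 1) => // -[//|n] _.
by rewrite mul1r -lerBlDr.
Qed.

End LowerEnvelope.

(** * The limit of the rates under a functionally invariant lower probability *)

Section RateLimit.
Context {R : realType} {d} {T : measurableType d}.
Variables (tau : T -> T) (nu : set T -> R) (M : set (probability T R)).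
Hypothesis mtau : measurable_fun [set: T] tau.
Hypothesis envM : is_lower_envelope M nu.
Hypothesis compactM : compact (M : set (setwise_probability R T)).
Hypothesis invM : M `<=` invariant_probabilities tau.

Let cnu : capacity nu := capacity_lower_envelope envM.

Section Process.
Variables (lam : R) (S : nat -> T -> R) (f : T -> R).
Hypothesis lam0 : 0 <= lam.
Hypothesis bS : bounded_process lam S.

Let bf_rate n : bounded_mfun (fun w => S n w / n%:R).
Proof.
split; last by exists lam => w; exact: lower_rate_bounded bS n.
case: n => [|n].
  by under eq_fun do rewrite invr0 mulr0; exact: measurable_cst.
by apply: measurable_funM => //; have [] := @bS n.+1 isT.
Qed.

(* Superadditivity and invariance of the Choquet integral make
   [n |-> choquet nu (S n)] superadditive. *)
Lemma choquet_superadditive_sup : convex_set_function nu ->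
  superadditive_process tau S -> measurable_fun [set: T] f ->
  (forall w, `|f w| <= lam) ->
  almost_surely nu (fun w => (S n w / n%:R) @[n --> \oo] --> f w) ->
  choquet nu f =
  sup [set choquet nu (fun w => S n w / n%:R) | n in [set n | (0 < n)%N]].
Proof.
move=> vnu superS mf flam Sf.
pose c n := choquet nu (fun w => S n w / n%:R).
pose K := (Num.truncn lam).+1.
have lamK : lam <= K%:R by rewrite ltW// truncnS_gt.
have c_cvg : c n @[n --> \oo] --> choquet nu f.
  apply: (choquet_cvg envM compactM (K := K)) => //.
  - by move=> n; case: (bf_rate n).
  - by move=> n w; rewrite (le_trans _ lamK)//; exact: lower_rate_bounded bS n.
  - by move=> w; exact: le_trans (flam w) lamK.
have bSn n : (0 < n)%N -> bounded_mfun (S n).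
  move=> n0; have [mS hS] := bS n0; split => //; exists (lam * n%:R) => w.
  by rewrite ler_norml -mulNr.
have cE n : (0 < n)%N -> choquet nu (S n) = n%:R * c n.
  move=> n0; rewrite -(choquet_scale cnu n0 (bf_rate n)); congr choquet.
  by apply/funext => w; rewrite mulrC divfK// pnatr_eq0 -lt0n.
have inv_iter k A : measurable A -> nu (iter k tau @^-1` A) = nu A.
  elim: k A => [//|k IHk] A mA; rewrite -[RHS](IHk A mA).
  rewrite -(lower_envelope_invariant envM mtau invM (A := iter k tau @^-1` A)).
    by congr nu; apply/funext => w /=; rewrite -iterSr.
  by rewrite -[X in measurable X]setTI; exact: measurable_iter.
have cD n k : (0 < n)%N -> (0 < k)%N ->
    choquet nu (S n) + choquet nu (S k) <= choquet nu (S (n + k)%N).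
  move=> n0 k0; rewrite -(choquet_comp cnu (inv_iter n) (f := S k)); last first.
    by have [] := bS k0.
  have bk : bounded_mfun (fun w => S k (iter n tau w)).
    exact/bounded_mfun_comp/bSn/k0/measurable_iter.
  apply: le_trans (choquet_superadd cnu vnu (bSn n n0) bk) _.
  apply: le_choquet => //; first exact: bounded_mfunD (bSn n n0) bk.
    by apply: bSn; rewrite addn_gt0 n0.
  exact: superS.
(* Cut time [m.+1 * n] into blocks of length [n] and iterate [cD]. *)
have cM n m : (0 < n)%N -> c n <= c (m.+1 * n)%N.
  move=> n0; have mn0 : (0 < m.+1 * n)%N by rewrite muln_gt0.
  rewrite -(ler_pM2l (_ : 0 < (m.+1 * n)%:R)) ?ltr0n// -cE// natrM -mulrA -cE//.
  elim: m {mn0} => [|m IHm]; first by rewrite mul1n mul1r.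
  rewrite mulSn -natr1 mulrDl mul1r addrC.
  by apply: le_trans (cD _ _ n0 _); rewrite ?lerD2l// muln_gt0.
have c_le n : (0 < n)%N -> c n <= choquet nu f.
  move=> n0; apply/ler_addgt0Pr => e e0.
  have /cvgrPdist_le/(_ _ e0)[N _ hN] := c_cvg.
  (* This multiple of [n] lies beyond [N], where [c] is within [e] of its limit. *)
  have := hN (N.+1 * n)%N; rewrite /= ler_norml.
  rewrite (leq_trans (leqnSn N)) ?leq_pmulr// => /(_ isT)/andP[h _].
  by apply: le_trans (cM n N n0) _; move: h; lra.
have ubc : has_ubound [set c n | n in [set n | (0 < n)%N]].
  by exists (choquet nu f) => _ [n /= n0 <-]; exact: c_le.
apply/eqP; rewrite eq_le; apply/andP; split.
  apply/ler_addgt0Pr => e e0; have /cvgrPdist_le/(_ _ e0)[N _ hN] := c_cvg.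
  have := hN N.+1 (leqnSn N); rewrite ler_norml => /andP[_ h].
  have : c N.+1 <= sup [set c n | n in [set n | (0 < n)%N]].
    by apply: ub_le_sup => //; exists N.+1.
  by move: h; rewrite -/(c _); lra.
apply: ge_sup; first by exists (c 1), 1%N.
by move=> _ [n /= n0 <-]; exact: c_le.
Qed.

End Process.

(** Expresses convergence through two measurable functions, so that convergence sets are
    measurable. *)
Lemma lower_rate_cvg lam (S : nat -> T -> R) w l : 0 <= lam ->
  bounded_process lam S -> (S n w / n%:R) @[n --> \oo] --> l <->
  lower_rate S w = l /\ lower_rate (fun n w => - S n w) w = - l.
Proof.
move=> lam0 bS; have rate_le := lower_rate_bounded w lam0 bS.
have lE : lower_rate (fun n w => - S n w) w = limn_inf (fun n => - (S n w / n%:R)).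
  by rewrite /lower_rate; under eq_fun do rewrite mulNr.
rewrite lE; split=> [Sl|[<- h]].
  split; first by have [] := cvg_limn_inf_sup Sl.
  by have [] := cvg_limn_inf_sup (cvgN Sl).
by apply: limn_inf_cvg rate_le _; rewrite h subrr.
Qed.

Lemma exists_rate_limit (lam : R) (S : nat -> T -> R) : 0 <= lam -> bounded_process lam S ->
  superadditive_process tau S \/ subadditive_process tau S ->
  exists f : T -> R, [/\ measurable_fun [set: T] f, forall w, `|f w| <= lam,
    forall w, f (tau w) = f w &
    almost_surely nu (fun w => (S n w / n%:R) @[n --> \oo] --> f w)].
Proof.
(* A superadditive S is treated through - S, with the limit negated. *)
move=> lam0; wlog subS : S / subadditive_process tau S => [hwlog bS|bS _].
  case=> [superS|subS]; last by apply: hwlog => //; right.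
  have subNS : subadditive_process tau (fun n w => - S n w).
    by move=> n k n0 k0 w; rewrite -opprD lerN2; exact: superS.
  have [f [mf flam ftau [A [mA nuA Af]]]] :=
    hwlog _ subNS (bounded_processN bS) (or_intror subNS).
  exists (fun w => - f w); split.
  - exact: measurable_funN.
  - by move=> w; rewrite normrN.
  - by move=> w; rewrite ftau.
  - exists A; split => // w Aw.
    have -> : (fun n => S n w / n%:R) = (fun n => - (- S n w / n%:R)).
      by apply/funext => n; rewrite mulNr opprK.
    exact: cvgN (Af w Aw).
have rate_le w := lower_rate_bounded w lam0 bS.
have [mS _] := bounded_mfun_lower_rate lam0 bS.
have [mNS _] := bounded_mfun_lower_rate lam0 (bounded_processN bS).
have Slam w : `|lower_rate S w| <= lam by exact: limn_inf_bounded.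
have Stau := lower_rate_le_comp lam0 bS subS.
have mf := measurable_orbit_limit mtau mS Slam Stau.
exists (orbit_limit tau (lower_rate S)); split => //.
- exact: orbit_limit_bounded Slam Stau.
- exact: orbit_limit_comp Slam Stau.
(* The convergence set does not depend on [P]; Kingman's theorem gives it full measure for every [P]
   in [M]. *)
pose A := [set w | lower_rate S w == orbit_limit tau (lower_rate S) w] `&`
  [set w | lower_rate (fun n w => - S n w) w == - orbit_limit tau (lower_rate S) w].
have mA : measurable A.
  apply: measurableI; rewrite -[X in measurable X]setTI; apply: measurable_fun_eqr => //.
  exact: measurable_funN.
have AE w : A w <-> (S n w / n%:R) @[n --> \oo] --> orbit_limit tau (lower_rate S) w.
  rewrite (lower_rate_cvg _ _ lam0 bS); split; first by move=> [/eqP ? /eqP].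
  by move=> [h1 h2]; split; apply/eqP.
exists A; split => //; last by move=> w /AE.
apply/(lower_envelope1P envM) => // P MP.
by apply: filterS (kingman mtau (invM MP) lam0 bS subS) => w /AE.
Qed.

Lemma bounded_measurable_invariant (f : T -> R) (lam : R) :
  measurable_fun [set: T] f -> (forall w, `|f w| <= lam) ->
  (forall w, f (tau w) = f w) -> bounded_measurable (invariant_sets tau) f.
Proof.
move=> mf flam ftau; split; last by exists lam.
move=> _ Y mY; rewrite setTI; apply: sub_gen_smallest; split.
  by rewrite -[X in measurable X]setTI; exact: mf.
by apply/funext => w /=; rewrite ftau.
Qed.

Lemma choquet_subadditive_inf (lam : R) (S : nat -> T -> R) (f : T -> R) :
  0 <= lam -> bounded_process lam S ->
  convex_set_function nu -> subadditive_process tau S ->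
  measurable_fun [set: T] f -> (forall w, `|f w| <= lam) ->
  almost_surely nu (fun w => (S n w / n%:R) @[n --> \oo] --> f w) ->
  choquet (conjugate nu) f =
  inf [set choquet (conjugate nu) (fun w => S n w / n%:R) | n in [set n | (0 < n)%N]].
Proof.
move=> lam0 bS vnu subS mf flam [A [mA nuA Af]].
have rateN n w : - S n w / n%:R = - (S n w / n%:R) by rewrite mulNr.
have bf_rate n : (0 < n)%N -> bounded_mfun (fun w => S n w / n%:R).
  move=> n0; split; last by exists lam => w; exact: lower_rate_bounded lam0 bS n.
  by apply: measurable_funM => //; have [] := bS _ n0.
rewrite choquet_conjugate//; last by split => //; exists lam.
rewrite (@choquet_superadditive_sup lam (fun n w => - S n w) (fun w => - f w))//.
- rewrite /inf; congr (- sup _); apply/seteqP; split=> x /=.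
    move=> [n n0 <-]; exists (choquet (conjugate nu) (fun w => S n w / n%:R)).
      by exists n.
    rewrite choquet_conjugate ?opprK//; last exact: bf_rate.
    by congr choquet; apply/funext => w; rewrite rateN.
  move=> [_ [n n0 <-] <-]; exists n => //.
  rewrite choquet_conjugate ?opprK//; last exact: bf_rate.
  by congr choquet; apply/funext => w; rewrite rateN.
- exact: bounded_processN.
- by move=> n k n0 k0 w; rewrite -opprD lerN2; exact: subS.
- exact: measurable_funN.
- by move=> w; rewrite normrN.
- exists A; split => // w Aw.
  have -> : (fun n => - S n w / n%:R) = (fun n => - (S n w / n%:R)) by exact/funext.
  exact: cvgN (Af w Aw).
Qed.

(** Level sets of [f] and - f are invariant, so ergodicity makes their capacities 0 or 1;
    [choquet_level1] for [f] gives the lower bound and for - f the upper one. *)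
Lemma ergodic_rate_limit (lam : R) (S : nat -> T -> R) (f : T -> R) :
  0 <= lam -> bounded_process lam S ->
  measurable_fun [set: T] f -> (forall w, `|f w| <= lam) ->
  (forall w, f (tau w) = f w) ->
  almost_surely nu (fun w => (S n w / n%:R) @[n --> \oo] --> f w) ->
  ergodic tau nu ->
  nu [set w | cvgn (fun n => S n w / n%:R) /\
    choquet nu f <= limn (fun n => S n w / n%:R) <= choquet (conjugate nu) f] = 1.
Proof.
move=> lam0 bS mf flam ftau [A [mA nuA Af]] erg.
have bf : bounded_mfun f by split => //; exists lam.
have nu01 (g : T -> R) : measurable_fun [set: T] g -> (forall w, g (tau w) = g w) ->
    forall t, nu [set w | t <= g w] = 0 \/ nu [set w | t <= g w] = 1.
  move=> mg gtau t; suff : [set 0; 1] (nu [set w | t <= g w]) by [].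
  rewrite -erg; exists [set w | t <= g w] => //; split; first exact: measurable_level.
  by apply/funext => w /=; rewrite gtau.
have lo := choquet_level1 envM bf (nu01 _ mf ftau).
have mNf : measurable_fun [set: T] (fun w => - f w) by exact: measurable_funN.
have hi := choquet_level1 envM (bounded_mfunN bf)
  (nu01 _ mNf (fun w => congr1 -%R (ftau w))).
rewrite choquet_conjugate//.
set c1 := choquet nu f in lo *; set c2 := choquet nu _ in hi *.
set W := [set w | _].
have [mS _] := bounded_mfun_lower_rate lam0 bS.
have [mNS _] := bounded_mfun_lower_rate lam0 (bounded_processN bS).
(* Rewriting convergence and limit by lower rates shows that [W] is measurable, as
   [lower_envelope1P] requires. *)
have WE : W = [set w | lower_rate (fun n w => - S n w) w == - lower_rate S w] `&`
    [set w | c1 <= lower_rate S w] `&` [set w | lower_rate S w <= - c2].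
  apply/seteqP; split=> w.
    move=> [Sw /andP[h1 h2]].
    have /(lower_rate_cvg _ _ lam0 bS)[e1 e2] := Sw.
    by rewrite -e1 in h1 h2; split; [split => //=; rewrite e1 e2|].
  move=> [[/= /eqP e h1] h2].
  have h : (S n w / n%:R) @[n --> \oo] --> lower_rate S w.
    by apply/(lower_rate_cvg _ _ lam0 bS).
  split; first by apply/cvg_ex; exists (lower_rate S w).
  by rewrite (cvg_lim _ h)// h1.
have mW : measurable W.
  rewrite WE; apply: measurableI; first apply: measurableI;
    rewrite -[X in measurable X]setTI.
  - by apply: measurable_fun_eqr => //; exact: measurable_funN.
  - exact: measurable_fun_ler.
  - exact: measurable_fun_ler.
apply/(lower_envelope1P envM) => // P MP.
have ae_of B : measurable B -> nu B = 1 -> {ae P, forall w, B w}.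
  by move=> mB /(lower_envelope1P envM mB); apply.
have aeA := ae_of _ mA nuA.
have aelo := ae_of _ (measurable_level _ mf) lo.
have aehi := ae_of _ (measurable_level _ mNf) hi.
near=> w.
have Aw : A w by near: w.
have low : c1 <= f w by near: w.
have hiw : c2 <= - f w by near: w.
split; first by apply/cvg_ex; exists (f w); exact: Af.
by rewrite (cvg_lim _ (Af w Aw))// low lerNr.
Unshelve. all: by end_near. Qed.

End RateLimit.

Theorem theorem3 (R : realType) (d : measure_display) (T : measurableType d)
    (hT : standard_borel R T)
    (tau : T -> T) (htau : measurable_fun [set: T] tau)
    (nu : set T -> R) (hnu : lower_probability nu)
    (S : nat -> T -> R)
    (hadd : superadditive_process tau S \/ subadditive_process tau S)
    (hmeas : forall n, (0 < n)%N -> measurable_fun [set: T] (S n))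
    (lam : R)
    (hbound : forall n, (0 < n)%N ->
       forall w, - lam * n%:R <= S n w <= lam * n%:R)
    (hinv : functionally_invariant tau nu) :
  exists fs : T -> R,
    [/\ bounded_measurable (invariant_sets tau) fs,
        almost_surely nu (fun w => (S n w / n%:R) @[n --> \oo] --> fs w),
        convex_set_function nu -> strongly_invariant tau nu ->
        superadditive_process tau S ->
          choquet nu fs =
          sup [set choquet nu (fun w => S n w / n%:R) | n in [set n | (0 < n)%N]],
        convex_set_function nu -> strongly_invariant tau nu ->
        subadditive_process tau S ->
          choquet (conjugate nu) fs =
          inf [set choquet (conjugate nu) (fun w => S n w / n%:R)
              | n in [set n | (0 < n)%N]] &
        ergodic tau nu -> subadditive_process tau S \/ superadditive_process tau S ->
          nu [set w | cvgn (fun n => S n w / n%:R) /\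
                      choquet nu fs <= limn (fun n => S n w / n%:R)
                        <= choquet (conjugate nu) fs] = 1].
Proof.
case: hinv => M [compactM envM invM].
(* The envelope contains a probability, so the space has a point, and the bound at [n = 1] there
   yields [0 <= lam]. *)
have [w0 _] : [set: T] !=set0.
  have [[P _ _] _] := envM _ measurableT; exact: probability_setT_nonempty P.
have lam0 : 0 <= lam by have := hbound 1 isT w0; rewrite !mulr1 => /andP[]; lra.
have bS : bounded_process lam S by move=> n n0; split; [exact: hmeas|exact: hbound].
have [f [mf flam ftau Sf]] := exists_rate_limit htau envM invM lam0 bS hadd.
exists f; split => //.
- exact: bounded_measurable_invariant mf flam ftau.
- by move=> vnu _ superS;
  exact: (choquet_superadditive_sup htau envM compactM invM lam0 bS vnu superS mf flam Sf).
- by move=> vnu _ subS;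
  exact: (choquet_subadditive_inf htau envM compactM invM lam0 bS vnu subS mf flam Sf).
- by move=> erg _; exact: (ergodic_rate_limit envM lam0 bS mf flam ftau Sf).
Qed.
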